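(* Let $g\ge1$ be an integer. For every hyperelliptic curve $X$ of genus $g$ over an algebraically closed field $k$ of any characteristic, embedded in its jacobian $J$ using a Weierstrass point $\infty$ as base point, we have $$\sharp (X\cap\tilde J[2g+1])\leq 8g^2\qquad\text{and}\qquad \sharp (X\cap\tilde J[2g+2])\leq 8g^2+4g.$$
   Context: $X$ is the smooth projective completion, by one point $\infty$, of a smooth affine curve $y^2+Q(x)y=P(x)$ with $P\in k[x]$ monic of degree $2g+1$ and $Q\in k[x]$ of degree at most $g$ (for $g=1$ it is an elliptic curve with origin $\infty$). $X$ is viewed as a subset of $J$ via $\xi\mapsto$ class of $[\xi]-[\infty]$. $J[N]$ is the subgroup of $J(k)$ of points of order dividing $N$, and $\tilde J[N]=J[N]\setminus J[2]$. *)

(* Defs.v *)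
From HB Require Import structures.
From mathcomp Require Import all_boot all_order all_algebra.
From mathcomp Require Import generic_quotient ring_quotient qpoly ring zify.
From mathcomp Require Import freeg.
From mathcomp Require Import boolp classical_sets cardinality.

Set Implicit Arguments.
Unset Strict Implicit.
Unset Printing Implicit Defensive.

Import GRing.Theory.
Local Open Scope ring_scope.

(* The affine curve y^2 + Q(x) y = P(x); curve_smooth is the Jacobian         *)
(* criterion, valid in every characteristic.                                  *)
Record hyperelliptic_curve (k : closedFieldType) (g : nat) :=
  HyperellipticCurve {
    curveP : {poly k};
    curveQ : {poly k};
    curveP_monic : curveP \is monic;
    size_curveP : size curveP = (2 * g + 2)%N;
    size_curveQ : (size curveQ <= g + 1)%N;
    curve_smooth : forall a b : k,
      b ^+ 2 + curveQ.[a] * b = curveP.[a] ->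
      (b *+ 2 + curveQ.[a] != 0) || (curveQ^`().[a] * b != curveP^`().[a])
  }.

(* The equation y^2 + Q y - P, as an element of k[x][y].                      *)
Definition curve_eq k g (C : hyperelliptic_curve k g) : {poly {poly k}} :=
  'X^2 + curveQ C *: 'X - (curveP C)%:P.

(* k[x,y] / (y^2 + Q y - P), a free k[x]-module with basis 1, y: an element f *)
(* is f`_0 + f`_1 y with f`_0, f`_1 in k[x].                                  *)
Notation coordinate_ring C := {poly %/ curve_eq C}.

Definition fun_x k g (C : hyperelliptic_curve k g) : coordinate_ring C :=
  in_qpoly (curve_eq C) 'X%:P.
Definition fun_y k g (C : hyperelliptic_curve k g) : coordinate_ring C :=
  in_qpoly (curve_eq C) 'X.
Definition fun_const k g (C : hyperelliptic_curve k g) (c : k) :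
    coordinate_ring C :=
  in_qpoly (curve_eq C) c%:P%:P.

Definition affine_point k g (C : hyperelliptic_curve k g) : choiceType :=
  {ab : k * k | ab.2 ^+ 2 + (curveQ C).[ab.1] * ab.2 == (curveP C).[ab.1]}.

(* The points of the completion X; None is the point at infinity.             *)
Definition curve_point k g (C : hyperelliptic_curve k g) : choiceType :=
  option (affine_point C).

Notation infty C := (None : curve_point C).

(* f lies in m^n, where m = (x - a, y - b) is the maximal ideal of the affine *)
(* point (a, b).                                                              *)
Definition in_max_ideal_pow k g (C : hyperelliptic_curve k g)
    (p : affine_point C) (n : nat) (f : coordinate_ring C) : Prop :=
  exists c : nat -> coordinate_ring C,
    f = \sum_(i < n.+1) c i * (fun_x C - fun_const C (val p).1) ^+ i
                            * (fun_y C - fun_const C (val p).2) ^+ (n - i).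

(* At infinity x has a pole of order 2 and y a pole of order 2g+1, so that    *)
(* the nonzero terms of u + v y have pole orders 2 deg u and                  *)
(* 2 deg v + 2g + 1, which have distinct parities.                            *)
Definition pole_order k g (C : hyperelliptic_curve k g)
    (f : coordinate_ring C) : nat :=
  let u := f`_0 in let v := f`_1 in
  maxn (2 * (size u).-1)
       (if v == 0 then 0%N else (2 * (size v).-1 + (2 * g + 1))%N).

(* The nonzero regular function f on the affine curve has order n at p. Since *)
(* m is maximal, m^n is the contraction of the n-th power of the maximal      *)
(* ideal of the local ring at p.                                              *)
Definition has_order k g (C : hyperelliptic_curve k g) (p : curve_point C)
    (f : coordinate_ring C) (n : int) : Prop :=
  match p with
  | Some q => exists2 m : nat, n = m%:Z
                & in_max_ideal_pow q m f /\ ~ in_max_ideal_pow q m.+1 f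
  | None => f != 0 /\ n = - (pole_order f)%:Z
  end.

(* D is the divisor of the rational function f / h on X; every nonzero        *)
(* rational function is such a quotient.                                      *)
Definition is_divisor_of k g (C : hyperelliptic_curve k g)
    (f h : coordinate_ring C) (D : {freeg curve_point C}) : Prop :=
  forall p : curve_point C, exists m n : int,
    [/\ has_order p f m, has_order p h n & coeff p D = m - n].

Definition deg_eq0 k g (C : hyperelliptic_curve k g) :
    {pred {freeg curve_point C}} :=
  fun D => deg D == 0.

Fact deg_eq0_zmod_closed k g (C : hyperelliptic_curve k g) :
  zmod_closed (@deg_eq0 k g C).
Proof.
split; first by rewrite unfold_in deg0.
by move=> D E; rewrite !unfold_in degB => /eqP-> /eqP->; rewrite subrr.
Qed.

HB.instance Definition _ k g (C : hyperelliptic_curve k g) :=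
  GRing.isZmodClosed.Build {freeg curve_point C} (@deg_eq0 k g C)
    (@deg_eq0_zmod_closed k g C).

Record divisor0 k g (C : hyperelliptic_curve k g) := Divisor0 {
  divisor0_val :> {freeg curve_point C};
  _ : deg_eq0 divisor0_val
}.

HB.instance Definition _ k g (C : hyperelliptic_curve k g) :=
  [isSub for @divisor0_val k g C].
HB.instance Definition _ k g (C : hyperelliptic_curve k g) :=
  [Choice of divisor0 C by <:].
HB.instance Definition _ k g (C : hyperelliptic_curve k g) :=
  [SubChoice_isSubZmodule of divisor0 C by <:].

Definition principal k g (C : hyperelliptic_curve k g) : {pred divisor0 C} :=
  fun D => `[< exists f h : coordinate_ring C, is_divisor_of f h D >].

Section MaxIdealPowers.
Context (k : fieldType) (A : comNzRingType) (X Y : A).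
Context (const : {rmorphism k -> A}) (ev : {rmorphism A -> k}).
Hypothesis const_ev : cancel const ev.
Hypothesis ker_ev : forall f, ev f = 0 <-> exists c d, f = c * X + d * Y.

Definition idpow n (f : A) : Prop :=
  exists c : nat -> A, f = \sum_(i < n.+1) c i * X ^+ i * Y ^+ (n - i).

Let evX : ev X = 0.
Proof. by apply/ker_ev; exists 1, 0; rewrite mul1r mul0r addr0. Qed.

Let evY : ev Y = 0.
Proof. by apply/ker_ev; exists 0, 1; rewrite mul1r mul0r add0r. Qed.

Lemma idpowD n f h : idpow n f -> idpow n h -> idpow n (f + h).
Proof.
case=> c -> [d ->]; exists (fun i => c i + d i); rewrite -big_split /=.
by apply: eq_bigr => i _; rewrite !mulrDl.
Qed.

Lemma idpow0 n : idpow n 0.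
Proof. by exists (fun=> 0); rewrite big1 // => i _; rewrite !mul0r. Qed.

Lemma idpowMl n a f : idpow n f -> idpow n (a * f).
Proof.
case=> c ->; exists (fun i => a * c i); rewrite mulr_sumr.
by apply: eq_bigr => i _; rewrite !mulrA.
Qed.

Lemma idpow_mon i j : idpow (i + j) (X ^+ i * Y ^+ j).
Proof.
exists (fun l => (l == i)%:R); have ii : (i < (i + j).+1)%N by lia.
rewrite (bigD1 (Ordinal ii)) //= eqxx mul1r addKn big1 ?addr0 // => l.
by rewrite -val_eqE /= => /negPf->; rewrite !mul0r.
Qed.

Lemma idpow_exp n f : ev f = 0 -> idpow n (f ^+ n).
Proof.
case/ker_ev => c [d ->]; rewrite exprDn.
apply: (big_ind (idpow n)); [exact: idpow0 | by move=> *; apply: idpowD |].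
move=> i _; rewrite -mulr_natl !exprMn.
rewrite [X in idpow _ X](_ : _ = ('C(n, i)%:R * c ^+ (n - i) * d ^+ i) *
  (X ^+ (n - i) * Y ^+ i)); last by ring.
have e : n = ((n - i) + i)%N by have := ltn_ord i; lia.
by apply: idpowMl; rewrite {1}e; apply: idpow_mon.
Qed.

Context (t o u w : A).
Hypothesis t_gen : ev t = 0.
Hypothesis tXY : t = X /\ o = Y \/ t = Y /\ o = X.
Hypothesis ev_u : ev u != 0.
Hypothesis u_o : u * o = w * t.
Hypothesis t_reg : forall f, t * f = 0 -> f = 0.

Let tn_reg n f h : t ^+ n * f = t ^+ n * h -> f = h.
Proof.
move/eqP; rewrite -subr_eq0 -mulrBr => /eqP tfh; apply/eqP; rewrite -subr_eq0.
apply/eqP; elim: n tfh => [|n IH]; first by rewrite mul1r.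
by rewrite exprS -mulrA => /t_reg /IH.
Qed.

Lemma idpowP n f :
  idpow n f <-> exists s h, ev s != 0 /\ s * f = t ^+ n * h.
Proof.
split=> [[c ->]|[s [h [evs sf]]]].
  have mon i j : exists h, u ^+ (i + j) * (X ^+ i * Y ^+ j) = t ^+ (i + j) * h.
    case: tXY => -[tE oE].
      exists (u ^+ i * w ^+ j).
      rewrite -tE -oE (_ : _ * _ = (u * t) ^+ i * (u * o) ^+ j); last first.
        by rewrite !exprMn exprD; ring.
      by rewrite u_o !exprMn exprD; ring.
    exists (u ^+ j * w ^+ i).
    rewrite -tE -oE (_ : _ * _ = (u * o) ^+ i * (u * t) ^+ j); last first.
      by rewrite !exprMn exprD; ring.
    by rewrite u_o !exprMn exprD; ring.
  exists (u ^+ n); suff [h hE] : exists h,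
      u ^+ n * (\sum_(i < n.+1) c i * X ^+ i * Y ^+ (n - i)) = t ^+ n * h.
    by exists h; rewrite rmorphXn expf_neq0.
  rewrite mulr_sumr.
  apply: (big_ind (fun x => exists h, x = t ^+ n * h)).
  - by exists 0; rewrite mulr0.
  - by move=> x y [hx ->] [hy ->]; exists (hx + hy); rewrite mulrDr.
  move=> i _; have [h hE] := mon i (n - i)%N.
  have e : (i + (n - i) = n)%N by have := ltn_ord i; lia.
  rewrite e in hE; exists (c i * h).
  by rewrite (mulrCA (t ^+ n)) -hE; ring.
pose a := const (ev s)^-1; pose m := 1 - s * a.
have evm : ev m = 0.
  by rewrite /m rmorphB rmorphM rmorph1 const_ev mulfV ?subrr.
have [b bE] : exists b, 1 = s * b + m ^+ n.
  have -> : m = 1 - s * a by [].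
  elim: n {sf} => [|n [b bE]]; first by exists 0; rewrite mulr0 add0r.
  exists (a + b * (1 - s * a)).
  rewrite exprS [X in _ = X](_ : _ =
    s * a + (1 - s * a) * (s * b + (1 - s * a) ^+ n)).
    by rewrite -bE; ring.
  by ring.
rewrite -[f]mul1r bE mulrDl (_ : s * b * f = b * (s * f)); last by ring.
rewrite sf; apply: idpowD.
  rewrite (_ : b * _ = (b * h) * t ^+ n); last by ring.
  by apply: idpowMl; apply: idpow_exp.
by rewrite mulrC; apply: idpowMl; apply: idpow_exp.
Qed.

Lemma idpow_ordP n f : (idpow n f /\ ~ idpow n.+1 f) <->
  exists s h, [/\ ev s != 0, ev h != 0 & s * f = t ^+ n * h].
Proof.
split=> [[/idpowP[s [h [evs sf]]] nf]|[s [h [evs evh sf]]]].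
  exists s, h; split=> //; apply/eqP => /ker_ev [c [d hE]].
  apply: nf; apply/idpowP.
  have [h' h'E] : exists h', u * h = t * h'.
    case: tXY => -[tE oE]; rewrite hE -tE -oE.
      by exists (u * c + d * w); rewrite mulrDr (mulrCA u d) u_o; ring.
    by exists (u * d + c * w); rewrite mulrDr (mulrCA u c) u_o; ring.
  exists (u * s), h'; split; first by rewrite rmorphM mulf_neq0.
  by rewrite -mulrA sf mulrCA h'E exprS; ring.
split; first by apply/idpowP; exists s, h.
case/idpowP => s' [h' [evs' s'f]].
have /tn_reg e : t ^+ n * (s' * h) = t ^+ n * (s * (t * h')).
  by rewrite mulrCA -sf mulrCA s'f exprS; ring.
have := congr1 ev e; rewrite !rmorphM /= t_gen mul0r mulr0 => /eqP.
by rewrite mulf_eq0 (negPf evs') (negPf evh).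
Qed.

Lemma idpow_ordM m n f h : idpow m f /\ ~ idpow m.+1 f ->
  idpow n h /\ ~ idpow n.+1 h ->
  idpow (m + n) (f * h) /\ ~ idpow (m + n).+1 (f * h).
Proof.
case/idpow_ordP => s [f' [evs evf' sf]] /idpow_ordP [r [h' [evr evh' rh]]].
apply/idpow_ordP; exists (s * r), (f' * h'); rewrite !rmorphM !mulf_neq0 //.
split=> //; rewrite (_ : s * r * _ = (s * f) * (r * h)); last by ring.
by rewrite sf rh exprD; ring.
Qed.

Lemma idpow_ord1 : idpow 0 1 /\ ~ idpow 1 1.
Proof.
by apply/idpow_ordP; exists 1, 1; rewrite rmorph1 oner_neq0 mulr1.
Qed.

End MaxIdealPowers.

Lemma size_norm_form (R : idomainType) (g : nat) (P Q u v : {poly R}) :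
  size P = (2 * g + 2)%N -> (size Q <= g + 1)%N -> (u, v) != (0, 0) ->
  size (u ^+ 2 - u * v * Q - v ^+ 2 * P) =
  (maxn (2 * (size u).-1)
        (if v == 0 then 0%N else (2 * (size v).-1 + (2 * g + 1))%N)).+1.
Proof.
move=> sP sQ uv0.
have P0 : P != 0 by rewrite -size_poly_gt0 sP; lia.
have sq (r : {poly R}) : r != 0 -> size (r ^+ 2)%R = (2 * (size r).-1).+1.
  move=> r0; rewrite -[LHS]prednK ?size_poly_gt0 ?expf_neq0 //.
  by rewrite size_exp mulnC.
have [v0 | v0] := eqVneq v 0.
  have u0 : u != 0 by apply: contra_neq uv0 => ->; rewrite v0.
  by rewrite v0 mulr0 mul0r expr0n mul0r !subr0 sq ?maxn0.
have v_gt0 : (0 < size v)%N by rewrite size_poly_gt0.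
have svP : size (v ^+ 2 * P)%R = (2 * (size v).-1 + (2 * g + 1)).+1.
  by rewrite size_mul ?expf_neq0 // sP sq //; lia.
have [-> | u0] := eqVneq u 0.
  by rewrite size_poly0 expr0n !mul0r !sub0r oppr0 add0r size_polyN svP; lia.
have u_gt0 : (0 < size u)%N by rewrite size_poly_gt0.
have suvQ : (size (u * v * Q)%R <= (size u).-1 + (size v).-1 + g.+1)%N.
  rewrite (leq_trans (size_polyMleq _ _)) // size_mul //.
  by move: (size u) (size v) (size Q) sQ u_gt0 v_gt0 => *; lia.
have suu := sq _ u0.
have [lt | ge] := ltnP (2 * (size v).-1 + (2 * g + 1)) (2 * (size u).-1).
  rewrite -addrA size_polyDl suu; first by lia.
  rewrite -opprD size_polyN.
  rewrite (leq_ltn_trans (size_polyD _ _)) // gtn_max svP.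
  by rewrite (leq_ltn_trans suvQ); lia.
rewrite addrC size_polyDl size_polyN svP; first by lia.
rewrite (leq_ltn_trans (size_polyD _ _)) // size_polyN gtn_max suu.
by rewrite (leq_ltn_trans suvQ); lia.
Qed.

Section CoordinateRing.
Context (k : closedFieldType) (g : nat) (C : hyperelliptic_curve k g).
Local Notation A := (coordinate_ring C).
Local Notation P := (curveP C).
Local Notation Q := (curveQ C).
Local Notation F := (curve_eq C).

Let size_QXP : (size (Q *: 'X - P%:P : {poly {poly k}})%R <= 2)%N.
Proof.
rewrite (leq_trans (size_polyD _ _)) // size_polyN geq_max.
rewrite (leq_trans (size_scale_leq _ _)) ?size_polyX //=.
by rewrite (leq_trans (size_polyC_leq1 _)).
Qed.

Lemma size_curve_eq : size F = 3%N.
Proof. by rewrite /F -addrA size_polyDl size_polyXn. Qed.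

Lemma curve_eq_monic : F \is monic.
Proof.
by rewrite monicE /F -addrA lead_coefDl ?lead_coefXn // size_polyXn.
Qed.

Lemma mk_monic_curve_eq : mk_monic F = F.
Proof. by rewrite /mk_monic size_curve_eq curve_eq_monic. Qed.

Definition fun_poly (p : {poly k}) : A := in_qpoly F p%:P.

Lemma curve_eqE :
  fun_y C ^+ 2 = fun_poly P - fun_poly Q * fun_y C.
Proof.
apply/eqP; rewrite -subr_eq0 opprB addrA -rmorphXn /= /fun_poly /fun_y.
rewrite -in_qpolyM -in_qpolyD mul_polyC -(rmorphB (in_qpoly F)).
apply/eqP/val_inj => /=.
by rewrite mk_monic_curve_eq Pdiv.RingMonic.rmodpp ?curve_eq_monic.
Qed.

Lemma in_qpoly_uv (u v : {poly k}) :
  (fun_poly u + fun_poly v * fun_y C : {poly {poly k}}) = u%:P + v *: 'X.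
Proof.
rewrite /fun_poly /fun_y -in_qpolyM -in_qpolyD mul_polyC in_qpoly_small //.
rewrite mk_monic_curve_eq size_curve_eq ltnS.
rewrite (leq_trans (size_polyD _ _)) // geq_max.
by rewrite (leq_trans (size_polyC_leq1 _)) //=
  (leq_trans (size_scale_leq _ _)) ?size_polyX.
Qed.

Lemma coef_uv0 u v : (fun_poly u + fun_poly v * fun_y C)`_0 = u.
Proof. by rewrite in_qpoly_uv !coefE mulr0 addr0. Qed.

Lemma coef_uv1 u v : (fun_poly u + fun_poly v * fun_y C)`_1 = v.
Proof. by rewrite in_qpoly_uv !coefE mulr1 add0r. Qed.

Lemma coordinate_ringE (f : A) :
  f = fun_poly f`_0 + fun_poly f`_1 * fun_y C.
Proof.
apply/val_inj; apply: etrans (esym (in_qpoly_uv _ _)); apply/polyP => i.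
rewrite !coefE; case: i => [|[|i]] /=; rewrite ?mulr0 ?addr0 ?mulr1 ?add0r //.
rewrite nth_default //.
have sF : size (mk_monic F) = 3%N by rewrite mk_monic_curve_eq size_curve_eq.
have := leq_trans (size_mk_monic f) (eq_leq sF); rewrite ltnS.
by move/leq_trans; apply.
Qed.

Lemma fun_polyD : {morph fun_poly : p q / p + q}.
Proof. by move=> p q; rewrite /fun_poly polyCD in_qpolyD. Qed.
Lemma fun_polyM : {morph fun_poly : p q / p * q}.
Proof. by move=> p q; rewrite /fun_poly polyCM in_qpolyM. Qed.
Lemma fun_polyN : {morph fun_poly : p / - p}.
Proof. by move=> p; rewrite /fun_poly polyCN raddfN. Qed.

Lemma coordinate_ringM (f h : A) :
  f * h = fun_poly (f`_0 * h`_0 + f`_1 * h`_1 * P) +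
    fun_poly (f`_0 * h`_1 + f`_1 * h`_0 - f`_1 * h`_1 * Q) * fun_y C.
Proof.
rewrite {1}(coordinate_ringE f) {1}(coordinate_ringE h).
rewrite !(fun_polyD, fun_polyN, fun_polyM).
set u := fun_poly f`_0; set v := fun_poly f`_1.
set u' := fun_poly h`_0; set v' := fun_poly h`_1.
rewrite [LHS](_ : _ = u * u' + (u * v' + v * u') * fun_y C
   + v * v' * fun_y C ^+ 2); last by ring.
by rewrite curve_eqE; ring.
Qed.

(* the norm of f = u + v y over k[x] *)
Definition cnorm (f : A) : {poly k} :=
  f`_0 ^+ 2 - f`_0 * f`_1 * Q - f`_1 ^+ 2 * P.

Lemma cnormM (f h : A) : cnorm (f * h) = cnorm f * cnorm h.
Proof. by rewrite /cnorm coordinate_ringM coef_uv0 coef_uv1; ring. Qed.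

Lemma size_cnorm (f : A) : f != 0 -> size (cnorm f) = (pole_order f).+1.
Proof.
move=> f0; apply: size_norm_form.
- exact: size_curveP.
- exact: size_curveQ.
apply: contra_neq f0 => -[u0 v0].
by rewrite [f]coordinate_ringE u0 v0 /fun_poly !rmorph0 mul0r addr0.
Qed.

Lemma pole_orderM (f h : A) : f != 0 -> h != 0 ->
  f * h != 0 /\ pole_order (f * h) = (pole_order f + pole_order h)%N.
Proof.
move=> f0 h0; have sf := size_cnorm f0; have sh := size_cnorm h0.
have nf0 : cnorm f != 0 by rewrite -size_poly_gt0 sf.
have nh0 : cnorm h != 0 by rewrite -size_poly_gt0 sh.
have fh0 : f * h != 0.
  apply/eqP => fh; have := mulf_neq0 nf0 nh0.
  by rewrite -cnormM fh /cnorm !coef0 !expr0n !mul0r !subr0 eqxx.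
split=> //; have := size_cnorm fh0.
by rewrite cnormM size_mul // sf sh; lia.
Qed.

Section LocalRing.
Variable p : affine_point C.
Let a := (val p).1.
Let b := (val p).2.

Let on_curve : b ^+ 2 + Q.[a] * b = P.[a].
Proof. exact/eqP/(valP p). Qed.

Definition fun_eval (f : A) : k := (f`_0).[a] + (f`_1).[a] * b.

Lemma fun_eval_zmod_morphism : zmod_morphism fun_eval.
Proof.
by move=> f h; rewrite /fun_eval !coefB !hornerE; ring.
Qed.

Lemma fun_eval_monoid_morphism : monoid_morphism fun_eval.
Proof.
split; first by rewrite /fun_eval !coefE !hornerE.
move=> f h; rewrite {1}/fun_eval coordinate_ringM coef_uv0 coef_uv1.
by rewrite !hornerE -on_curve /fun_eval; ring.
Qed.

HB.instance Definition _ :=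
  GRing.isZmodMorphism.Build A k fun_eval fun_eval_zmod_morphism.
HB.instance Definition _ :=
  GRing.isMonoidMorphism.Build A k fun_eval fun_eval_monoid_morphism.

Lemma fun_const_zmod_morphism : zmod_morphism (fun_const C).
Proof. by move=> x y; rewrite /fun_const !polyCB rmorphB. Qed.
Lemma fun_const_monoid_morphism : monoid_morphism (fun_const C).
Proof.
by split=> [|x y]; rewrite /fun_const ?polyC1 ?rmorph1 // !polyCM rmorphM.
Qed.
HB.instance Definition _ :=
  GRing.isZmodMorphism.Build k A (fun_const C) fun_const_zmod_morphism.
HB.instance Definition _ :=
  GRing.isMonoidMorphism.Build k A (fun_const C) fun_const_monoid_morphism.

Let X := fun_x C - fun_const C a.
Let Y := fun_y C - fun_const C b.

Lemma fun_eval_uv u v :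
  fun_eval (fun_poly u + fun_poly v * fun_y C) = u.[a] + v.[a] * b.
Proof. by rewrite /fun_eval coef_uv0 coef_uv1. Qed.

Lemma fun_eval_poly u : fun_eval (fun_poly u) = u.[a].
Proof.
have := fun_eval_uv u 0; rewrite horner0 mul0r addr0 => <-.
by rewrite {3}/fun_poly polyC0 rmorph0 mul0r addr0.
Qed.

Lemma fun_eval_y : fun_eval (fun_y C) = b.
Proof.
have := fun_eval_uv 0 1; rewrite horner0 add0r hornerC mul1r => <-.
by rewrite /fun_poly polyC0 rmorph0 add0r rmorph1 mul1r.
Qed.

Lemma fun_const_eval : cancel (fun_const C) fun_eval.
Proof. by move=> c; apply: etrans (fun_eval_poly c%:P) _; rewrite hornerC. Qed.

Lemma fun_eval_X : fun_eval X = 0.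
Proof.
by rewrite rmorphB /= fun_const_eval -[fun_x C]/(fun_poly 'X) fun_eval_poly
  hornerX subrr.
Qed.

Lemma fun_eval_Y : fun_eval Y = 0.
Proof. by rewrite rmorphB /= fun_const_eval fun_eval_y subrr. Qed.

Lemma fun_poly_sub u : exists q, u - u.[a]%:P = q * ('X - a%:P) /\
  q.[a] = u^`().[a].
Proof.
have /factor_theorem [q qE] : root (u - u.[a]%:P) a.
  by rewrite rootE !hornerE subrr.
exists q; split=> //.
have := congr1 (fun r => (r^`()).[a]) qE.
rewrite /= derivB derivC subr0 => ->.
by rewrite derivM derivXsubC !hornerE subrr mulr0 add0r.
Qed.

Lemma fun_X : fun_poly ('X - a%:P) = X.
Proof. by rewrite fun_polyD fun_polyN. Qed.

Lemma fun_eval_ker (f : A) : fun_eval f = 0 <-> exists c d, f = c * X + d * Y.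
Proof.
split=> [f0|[c [d ->]]]; last first.
  by rewrite rmorphD !rmorphM /= fun_eval_X fun_eval_Y !mulr0 addr0.
rewrite /fun_eval in f0; have [q [qE _]] := fun_poly_sub (f`_0 + f`_1 * b%:P).
exists (fun_poly q), (fun_poly f`_1).
rewrite -fun_X -fun_polyM -qE !hornerE f0 polyC0 subr0.
rewrite fun_polyD fun_polyM [fun_poly b%:P]/(fun_const C b).
by rewrite {1}[f]coordinate_ringE /Y; ring.
Qed.

Lemma fun_tangent : exists u w : A,
  [/\ u * Y = w * X, fun_eval u = b *+ 2 + Q.[a]
    & fun_eval w = P^`().[a] - Q^`().[a] * b].
Proof.
have [q [qE qa]] := fun_poly_sub Q; have [r [rE ra]] := fun_poly_sub P.
exists (fun_y C + fun_const C b + fun_poly Q).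
exists (fun_poly r - fun_poly q * fun_const C b).
rewrite -fun_X; split; last 2 first.
- by rewrite !rmorphD /= fun_eval_y fun_const_eval fun_eval_poly.
- by rewrite rmorphB rmorphM /= fun_const_eval !fun_eval_poly qa ra.
rewrite mulrBl -[_ * _ * fun_poly ('X - _)]mulrA.
rewrite [fun_const C b * _]mulrC mulrA -!fun_polyM -qE -rE.
rewrite !(fun_polyD, fun_polyN) -on_curve.
rewrite -![fun_poly _%:P]/(fun_const C _) !rmorphD !rmorphM /=.
rewrite /Y [LHS](_ : _ = fun_y C ^+ 2 + fun_poly Q * fun_y C
  - fun_const C b ^+ 2 - fun_const C b * fun_poly Q); last by ring.
rewrite curve_eqE fun_polyM fun_polyD fun_polyN.
by rewrite -![fun_poly _%:P]/(fun_const C _); ring.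
Qed.

Lemma fun_poly_reg u (f : A) : u != 0 -> fun_poly u * f = 0 -> f = 0.
Proof.
move=> u0; rewrite [f]coordinate_ringE mulrDr mulrA -!fun_polyM.
move=> e; have := coef_uv0 (u * f`_0) (u * f`_1).
have := coef_uv1 (u * f`_0) (u * f`_1); rewrite e !coef0.
move/esym/eqP; rewrite mulf_eq0 (negPf u0) => /eqP->.
move/esym/eqP; rewrite mulf_eq0 (negPf u0) => /eqP->.
by rewrite /fun_poly polyC0 rmorph0 mul0r addr0.
Qed.

Lemma fun_X_reg f : X * f = 0 -> f = 0.
Proof. by rewrite -fun_X; apply: fun_poly_reg; rewrite polyXsubC_eq0. Qed.

Lemma fun_Y_reg f : Y * f = 0 -> f = 0.
Proof.
pose N := P - (b ^+ 2)%:P - b *: Q.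
have N0 : N != 0.
  rewrite -size_poly_gt0 /N -addrA size_polyDl size_curveP; first by lia.
  rewrite (leq_ltn_trans (size_polyD _ _)) // !size_polyN gtn_max.
  rewrite (leq_ltn_trans (size_polyC_leq1 _)); last by lia.
  rewrite (leq_ltn_trans (size_scale_leq _ _)) //.
  by rewrite (leq_ltn_trans (size_curveQ C)); lia.
move=> e; apply: (fun_poly_reg N0).
rewrite (_ : fun_poly N = (fun_y C + fun_const C b + fun_poly Q) * Y).
  by rewrite -mulrA e mulr0.
rewrite /N -mul_polyC !(fun_polyD, fun_polyN, fun_polyM).
rewrite -![fun_poly _%:P]/(fun_const C _) rmorphXn /= /Y.
rewrite [RHS](_ : _ = fun_y C ^+ 2 + fun_poly Q * fun_y C
  - fun_const C b ^+ 2 - fun_const C b * fun_poly Q); last by ring.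
by rewrite curve_eqE; ring.
Qed.

Lemma max_ideal_ordM m n (f h : A) :
  in_max_ideal_pow p m f /\ ~ in_max_ideal_pow p m.+1 f ->
  in_max_ideal_pow p n h /\ ~ in_max_ideal_pow p n.+1 h ->
  in_max_ideal_pow p (m + n) (f * h) /\
  ~ in_max_ideal_pow p (m + n).+1 (f * h).
Proof.
have [u [w [uw eu ew]]] := fun_tangent.
have /orP[s|s] := curve_smooth on_curve.
  by apply: (@idpow_ordM k A X Y (fun_const C) fun_eval fun_const_eval
    fun_eval_ker X Y u w) => //; [exact: fun_eval_X | left | rewrite /= eu
    | exact: fun_X_reg].
apply: (@idpow_ordM k A X Y (fun_const C) fun_eval fun_const_eval
    fun_eval_ker Y X w u) => //; [exact: fun_eval_Y | right=> // | 
    | exact: fun_Y_reg].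
by rewrite /= ew subr_eq0 eq_sym.
Qed.

Lemma max_ideal_ord1 :
  in_max_ideal_pow p 0 1 /\ ~ in_max_ideal_pow p 1 1.
Proof.
have [u [w [uw eu ew]]] := fun_tangent.
have /orP[s|s] := curve_smooth on_curve.
  by apply: (@idpow_ord1 k A X Y (fun_const C) fun_eval fun_const_eval
    fun_eval_ker X Y u w) => //; [exact: fun_eval_X | left | rewrite /= eu
    | exact: fun_X_reg].
apply: (@idpow_ord1 k A X Y (fun_const C) fun_eval fun_const_eval
    fun_eval_ker Y X w u) => //; [exact: fun_eval_Y | right=> // | 
    | exact: fun_Y_reg].
by rewrite /= ew subr_eq0 eq_sym.
Qed.

End LocalRing.

Lemma has_orderM (p : curve_point C) (f h : A) (m n : int) :
  has_order p f m -> has_order p h n -> has_order p (f * h) (m + n).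
Proof.
case: p => [q|] /=.
  move=> [i -> fi] [j -> hj]; exists (i + j)%N; first by rewrite PoszD.
  exact: max_ideal_ordM.
move=> [f0 ->] [h0 ->]; have [fh0 ->] := pole_orderM f0 h0.
by split; rewrite // PoszD opprD.
Qed.

Lemma has_order1 (p : curve_point C) : has_order p 1 0.
Proof.
case: p => [q|] /=; first by exists 0%N => //; exact: max_ideal_ord1.
split; first exact: oner_neq0.
by rewrite /pole_order !coefE /= eqxx mulr1n size_poly1 oppr0.
Qed.

Fact principal_zmod_closed : zmod_closed (@principal k g C).
Proof.
split=> [|D E].
  apply/asboolP; exists 1, 1 => p; exists 0, 0.
  by split; rewrite ?subrr ?coeff0 //; apply: has_order1.
move=> /asboolP[f [h fh]] /asboolP[f' [h' fh']].
apply/asboolP; exists (f * h'), (h * f') => p.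
have [m [n [fm hn Dp]]] := fh p; have [m' [n' [fm' hn' Ep]]] := fh' p.
exists (m + n'), (n + m'); split; try exact: has_orderM.
by rewrite /= coeffB Dp Ep; ring.
Qed.

HB.instance Definition _ :=
  GRing.isZmodClosed.Build (divisor0 C) (@principal k g C)
    principal_zmod_closed.

End CoordinateRing.

(* J(k), identified with Pic^0(X): divisors of degree 0 modulo principal ones. *)
Definition jacobian k g (C : hyperelliptic_curve k g) : zmodType :=
  Quotient.quot (@principal k g C).

Fact abel_jacobi_subproof k g (C : hyperelliptic_curve k g)
    (p : curve_point C) :
  deg_eq0 (<< p >> - << infty C >>).
Proof. by rewrite /deg_eq0 degB !degU subrr. Qed.

Definition abel_jacobi k g (C : hyperelliptic_curve k g) (p : curve_point C) :
    jacobian C :=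
  \pi_(jacobian C)%qT (Divisor0 (abel_jacobi_subproof p)).

Definition torsion (G : zmodType) (N : nat) : set G :=
  [set c | c *+ N = 0]%classic.

Arguments torsion : clear implicits.

(* Main.v *)
From HB Require Import structures.
Require Import Defs.
From mathcomp Require Import all_boot all_order all_algebra.
From mathcomp Require Import generic_quotient qpoly ring_quotient ring zify.
From mathcomp Require Import freeg.
From mathcomp Require Import boolp classical_sets cardinality.

(** Write N = m + g + 1 with m = g or m = g + 1, and w = 2y + Q.

    Let p = (a, b) be a point killed by N.  A function with divisor
    N p - N oo has the form u(x) + v(x) y; the pole order N forces v to be
    constant, and if w(p) <> 0 it is nonzero, so that the function is y - r(x)
    up to a scalar, with deg r <= m.  Its norm down to k[x] vanishes only at a,
    hence r^2 + Q r - P = c (x - a)^N ([torsion_contact]).  When w(p) = 0 the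
    divisor of x - a is 2 p - 2 oo, so the points with w = 0 are 2-torsion and
    may be ignored.

    Where w <> 0, y is a power series in x - a.  Its i-th coefficient is, as a
    function of the point, E_i / w^(2i-1) with E_i regular on the affine curve
    and of pole order at most 4 g i ([slope_bounded_taylor],
    [numer_taylor]).  At a point p as above y agrees with the polynomial r to
    order N, so E_i(p) = 0 for m < i < N, and likewise at the conjugate of p.
    If E_i = u + v y is not the zero function, then u(a) = v(a) = 0, which
    leaves at most 2 g i values of a, that is at most 4 g i <= 4 g (N - 1)
    points.  For N = 2g + 1 and N = 2g + 2 these are the two bounds.

    It remains to see, in every characteristic, that some E_i with
    m < i < N is nonzero ([numerator_neq0]).  Suppose that all of them are
    zero.  Then every point with w <> 0 has its own relation
    r^2 + Q r - P = c (x - a)^N.  Moving the point to first order, over the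
    dual numbers, shows that i + 1 times the coefficient of index i + 1 is the
    derivative of the coefficient of index i.  For i = N - 1 this gives N = 0
    in k, because the coefficient of index N is - c / w and c <> 0
    ([contact_of_taylor]).  Therefore the right-hand side of the relation
    has zero derivative, and this is impossible for infinitely many a
    ([no_full_contact]): in odd characteristic s = 2r + Q satisfies
    s^2 = F + 4c (x - a)^N with F = 4P + Q^2, so that 2 s s' = F' leaves
    finitely many s up to a scalar; in characteristic 2 the relation
    (Q r)' = P' determines r at a root of Q. *)

Set Implicit Arguments.
Unset Strict Implicit.
Unset Printing Implicit Defensive.
Import GRing.Theory.
Local Open Scope ring_scope.

(** * Taylor coefficients of a branch without denominators *)

Section LowOrder.
Context (R : comNzRingType).
Implicit Types (f h : {poly R}) (n : nat).

(** Divisibility of f by 'X^n, in the form that is convenient for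
    coefficientwise arguments. *)
Definition low n f := forall i, (i < n)%N -> f`_i = 0.

Lemma lowD n f h : low n f -> low n h -> low n (f + h).
Proof. by move=> fn hn i lt_in; rewrite coefD fn ?hn ?addr0. Qed.

Lemma lowB n f h : low n f -> low n h -> low n (f - h).
Proof. by move=> fn hn i lt_in; rewrite coefB fn ?hn ?subr0. Qed.

Lemma lowM m n f h : low m f -> low n h -> low (m + n) (f * h).
Proof.
move=> fm hn i lt_i; rewrite coefM big1 // => j _.
have [lt_jm|le_mj] := ltnP j m; first by rewrite fm ?mul0r.
by rewrite [h`_ _]hn ?mulr0 //; have := ltn_ord j; lia.
Qed.

Lemma lowMl n f h : low n h -> low n (f * h).
Proof. by move=> hn; apply: (@lowM 0 n). Qed.

Lemma low_le m n f : (m <= n)%N -> low n f -> low m f.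
Proof. by move=> le_mn fn i lt_im; apply: fn; apply: leq_trans le_mn. Qed.

Lemma low_regular n f h :
  (forall c, c * h`_0 = 0 -> c = 0) -> low n (f * h) -> low n f.
Proof.
move=> h_reg fhn i; elim/ltn_ind: i => i IH lt_in; apply: h_reg.
have := fhn i lt_in; rewrite coefM big_ord_recr /= subnn big1 ?add0r // => j _.
by rewrite IH ?mul0r //; have := ltn_ord j; lia.
Qed.

Lemma coef_comp_scale f c i : (f \Po (c *: 'X))`_i = c ^+ i * f`_i.
Proof.
rewrite comp_polyE coef_sum; have [lt_i|le_i] := ltnP i (size f).
  rewrite (bigD1 (Ordinal lt_i)) //= exprZn !coefZ coefXn eqxx mulr1 mulrC.
  rewrite big1 ?addr0 // => j; rewrite -val_eqE /= eq_sym => /negPf ne_ij.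
  by rewrite exprZn !coefZ coefXn ne_ij !mulr0.
rewrite nth_default // mulr0 big1 // => j _.
rewrite exprZn !coefZ coefXn (_ : i == j = false) ?mulr0 //.
by have := ltn_ord j; lia.
Qed.

(** The Taylor formula: the coefficients of f(T + c) are the divided
    derivatives of f at c. *)
Lemma coef_comp_shift f c i : (f \Po ('X + c%:P))`_i = (f^`N(i)).[c].
Proof.
have : GRing.comm c%:P 'X by exact: mulrC.
move=> /(nderiv_taylor (map_poly polyC f)) E.
have -> : f \Po ('X + c%:P) = \sum_(j < size f) (f^`N(j)).[c] *: 'X^j.
  rewrite /comp_poly addrC E size_map_inj_poly ?polyC0 //; last exact: polyC_inj.
  apply: eq_bigr => j _; rewrite nderivn_map horner_map /=.
  by rewrite mul_polyC.
rewrite coef_sum; have [lt_i|le_i] := ltnP i (size f).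
  rewrite (bigD1 (Ordinal lt_i)) //= !coefZ coefXn eqxx mulr1.
  rewrite big1 ?addr0 // => j; rewrite -val_eqE /= eq_sym => /negPf ne_ij.
  by rewrite coefZ coefXn ne_ij mulr0.
rewrite nderivn_poly0 // horner0 big1 // => j _.
rewrite coefZ coefXn (_ : i == j = false) ?mulr0 //.
by have := ltn_ord j; lia.
Qed.

End LowOrder.

(** The coefficients of a branch are found one at a time: the n-th equation is
    linear in the n-th coefficient, with leading factor 2b + Q(0). *)
Lemma hensel (k : fieldType) (P Q : {poly k}) (b : k) (n : nat) :
  b ^+ 2 + Q`_0 * b = P`_0 -> b *+ 2 + Q`_0 != 0 ->
  exists Z : {poly k}, Z`_0 = b /\ low n.+1 (Z ^+ 2 + Q * Z - P).
Proof.
move=> eqb w0; elim: n => [|n [Z [Z0 IH]]].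
  exists b%:P; split; first by rewrite coefC.
  move=> [|//] _; rewrite coefB coefD expr2 !coef0M coefC /=.
  by rewrite -expr2 eqb subrr.
move: IH; move SE : (Z ^+ 2 + Q * Z - P) => S IH.
pose c := - S`_n.+1 / (b *+ 2 + Q`_0).
exists (Z + c *: 'X^(n.+1)); split.
  by rewrite coefD coefZ coefXn mulr0 addr0.
rewrite [X in low _ X](_ : _ = S + (c *: 'X^(n.+1)) * (Z *+ 2 + Q)
    + (c *: 'X^(n.+1)) ^+ 2); last by rewrite -SE; ring.
have lowX : low n.+1 (c *: 'X^(n.+1)).
  by move=> i lt_i; rewrite coefZ coefXn ltn_eqF // mulr0.
apply: lowD; last first.
  by rewrite expr2; apply: low_le (lowM lowX lowX); rewrite addSn !ltnS leq_addl.
move=> i; rewrite ltnS leq_eqVlt => /predU1P[->|lt_i]; last first.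
  by apply: (lowD IH) => //; rewrite mulrC; apply: lowMl.
rewrite coefD -scalerAl coefZ coefXnM ltnn subnn coefD coefMn Z0.
by rewrite /c mulfVK // subrr.
Qed.

Section TaylorNumerators.
Context (k : nzRingType) (A : comNzRingType) (iota : {rmorphism k -> A}).
Context (P Q : {poly k}) (x y : A).

Local Notation at_x u := (map_poly iota u).[x].

Definition tangent_den : A := y *+ 2 + at_x Q.
Local Notation w := tangent_den.

(** This is the polynomial (u(x + w^2 T) - u(x)) / w^2; see
    [comp_increment]. *)
Definition increment (u : {poly k}) : {poly A} :=
  \poly_(j < size u) (if j is i.+1 then at_x u^`N(j) * w ^+ (2 * i) else 0).

(** Put x + w^2 T for x and y + w Y for y in the curve equation, with
    Y(0) = 0.  The terms free of T cancel, and every remaining term is divisible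
    by w^2: the quotient is the equation Y = numer_step Y.  No denominator is
    left, and since increments have no constant term the step is contracting
    for the T-adic topology, so that iterating it from 0 converges. *)
Definition numer_step (Y : {poly A}) : {poly A} :=
  increment P - y *: increment Q - w *: (increment Q * Y) - Y ^+ 2.

Definition numer (n : nat) : {poly A} := iter n numer_step 0.

Lemma increment0 u : (increment u)`_0 = 0.
Proof. by rewrite coef_poly; case: ifP. Qed.

Lemma coef_increment u i :
  (increment u)`_i.+1 = at_x u^`N(i.+1) * w ^+ (2 * i).
Proof.
rewrite coef_poly; case: ltnP => // le_u.
by rewrite nderivn_poly0 // rmorph0 horner0 mul0r.
Qed.

Lemma numer_step0 (Y : {poly A}) : Y`_0 = 0 -> (numer_step Y)`_0 = 0.
Proof.
by move=> Y0; rewrite !coefB !coefZ expr2 !coef0M Y0 !increment0 !(mulr0, subr0).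
Qed.

Lemma numer0 n : (numer n)`_0 = 0.
Proof. by elim: n => [|n IH]; rewrite ?coef0 //; apply: numer_step0. Qed.

Lemma numer_stepB (Y1 Y2 : {poly A}) : numer_step Y1 - numer_step Y2 =
  - (w *: increment Q + Y1 + Y2) * (Y1 - Y2).
Proof.
by rewrite /numer_step -!mul_polyC; ring.
Qed.

Lemma numer_fix n : low n.+1 (numer_step (numer n) - numer n).
Proof.
elim: n => [|n IH]; first by case=> [|//] _; rewrite subr0 numer_step0 ?coef0.
have step0 := numer_step0 (numer0 n).
rewrite (_ : numer n.+1 = numer_step (numer n)) // numer_stepB.
apply: (@lowM _ 1) IH => -[|//] _.
by rewrite coefN 2!coefD coefZ increment0 step0 numer0 mulr0 !addr0 oppr0.
Qed.

Lemma comp_increment u :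
  (map_poly iota u \Po ('X + x%:P)) \Po (w ^+ 2 *: 'X) =
  (at_x u)%:P + w ^+ 2 *: increment u.
Proof.
apply/polyP => i; rewrite coef_comp_scale coef_comp_shift coefD coefC coefZ.
case: i => [|i]; first by rewrite increment0 mulr0 addr0 mul1r nderivn0.
by rewrite coef_increment add0r nderivn_map /= exprS -exprM; ring.
Qed.

(** The i-th Taylor coefficient of y is the i-th coefficient of the fixed
    point divided by w^(2i-1).  Both (Z(w^2 T) - y) / w and [numer n] are fixed
    points of [numer_step] modulo T^(n+1), and the fixed point is unique. *)
Theorem numer_taylor (n : nat) (v : A) (Z : {poly A}) :
    w * v = 1 -> Z`_0 = y ->
    low n.+1 (Z ^+ 2 + (map_poly iota Q \Po ('X + x%:P)) * Z
              - (map_poly iota P \Po ('X + x%:P))) ->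
  forall i, (0 < i <= n)%N -> w ^+ (2 * i) * Z`_i = w * (numer n)`_i.
Proof.
move=> wv Z0 lowZ i /andP[i_gt0 le_in].
pose Z' := Z \Po (w ^+ 2 *: 'X); pose Y := v *: (Z' - y%:P).
have w_reg c : c * w = 0 -> c = 0.
  by move=> cw; rewrite -[c]mulr1 -wv mulrA cw mul0r.
have w2_reg c : c * w ^+ 2 = 0 -> c = 0.
  by rewrite expr2 mulrA => /w_reg/w_reg.
have Z'E : Z' = y%:P + w *: Y by rewrite scalerA wv scale1r addrC subrK.
have Z'0 : Z'`_0 = y by rewrite coef_comp_scale mul1r.
have Y0 : Y`_0 = 0 by rewrite coefZ coefB coefC Z'0 subrr mulr0.
have eqy : y ^+ 2 + at_x Q * y = at_x P.
  apply/eqP; rewrite -subr_eq0 -[at_x Q]/((map_poly iota Q)).[x].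
  have := lowZ 0%N isT; rewrite coefB coefD expr2 !coef0M Z0 !coef_comp_shift.
  by rewrite !nderivn0 -expr2 => ->.
(* The equation of the branch Z, rescaled and divided by w^2. *)
have lowZ' : low n.+1 (w ^+ 2 *: (Y - numer_step Y)).
  rewrite [X in low _ X](_ : _ = (Z ^+ 2 + (map_poly iota Q \Po ('X + x%:P)) * Z
      - (map_poly iota P \Po ('X + x%:P))) \Po (w ^+ 2 *: 'X)).
    by move=> j lt_j; rewrite coef_comp_scale lowZ ?mulr0.
  rewrite rmorphB rmorphD rmorphXn rmorphM /= !comp_increment -/Z' Z'E -eqy.
  rewrite /numer_step /w -!mul_polyC.
  by rewrite !(rmorphD, rmorphM, rmorphXn, rmorphMn) /=; ring.
have lowY : low n.+1 (Y - numer_step Y).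
  by move=> j lt_j; apply: w2_reg; rewrite mulrC -coefZ lowZ'.
have : low n.+1 (Y - numer n).
  apply: (@low_regular _ _ _ (1 + (w *: increment Q + Y + numer n))).
    move=> c; rewrite !coefD coefZ increment0 numer0 Y0 coefC /=.
    by rewrite mulr0 !addr0 mulr1.
  rewrite [X in low _ X](_ : _ = (Y - numer_step Y) +
    (numer_step (numer n) - numer n)); first exact: (lowD lowY (@numer_fix n)).
  rewrite mulrDr mulr1 [_ * (_ + _ + _)]mulrC -[X in _ + X]opprK -mulNr.
  rewrite -numer_stepB.
  by ring.
move=> /(_ i le_in)/eqP; rewrite coefB subr_eq0 => /eqP <-.
have -> : w * Y`_i = Z'`_i.
  by rewrite Z'E coefD coefC (gtn_eqF i_gt0) add0r [RHS]coefZ.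
by rewrite coef_comp_scale -exprM.
Qed.

End TaylorNumerators.

Lemma map_numer (k : nzRingType) (A B : comNzRingType)
    (iota : {rmorphism k -> A}) (phi : {rmorphism A -> B}) P Q x y n :
  map_poly phi (numer iota P Q x y n) =
  numer (phi \o iota) P Q (phi x) (phi y) n.
Proof.
have hornerE u : phi (map_poly iota u).[x] = (map_poly (phi \o iota) u).[phi x].
  by rewrite map_poly_comp horner_map.
have denE : phi (tangent_den iota Q x y) =
    tangent_den (phi \o iota) Q (phi x) (phi y).
  by rewrite rmorphD rmorphMn /= hornerE.
have incE u : map_poly phi (increment iota Q x y u) =
    increment (phi \o iota) Q (phi x) (phi y) u.
  apply/polyP => -[|i]; rewrite coef_map /= ?increment0.
    exact: rmorph0.
  by rewrite !coef_increment rmorphM rmorphXn /= hornerE denE.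
elim: n => [|n IH]; first exact: rmorph0.
rewrite /= {1}/numer_step !rmorphB /= !map_polyZ rmorphXn rmorphM /= IH denE.
by rewrite !incE.
Qed.

(** * No contact of order N at all points when N = 0 in k *)

Section ClosedField.
Context (k : closedFieldType).

Lemma quadratic_root (q p : k) : exists b, b ^+ 2 + q * b = p.
Proof.
have : size ('X^2 + (q *: 'X - p%:P) : {poly k}) != 1%N.
  rewrite size_polyDl size_polyXn // (leq_ltn_trans (size_polyD _ _)) //.
  rewrite size_polyN gtn_max (leq_ltn_trans (size_scale_leq _ _)) ?size_polyX //=.
  by rewrite (leq_ltn_trans (size_polyC_leq1 _)).
case/closed_rootP => b; rewrite rootE !hornerE /= => /eqP E; exists b.
by apply/eqP; rewrite -subr_eq0 -E; apply/eqP; ring.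
Qed.

Lemma quadratic_roots (q b b' : k) :
  b' ^+ 2 + q * b' = b ^+ 2 + q * b -> b' = b \/ b' = - q - b.
Proof.
move=> E; have : (b' - b) * (b' - (- q - b)) = 0.
  have -> : (b' - b) * (b' - (- q - b)) = b' ^+ 2 + q * b' - (b ^+ 2 + q * b).
    by ring.
  by rewrite E subrr.
by move/eqP; rewrite mulf_eq0 !subr_eq0 => /orP[]/eqP; [left | right].
Qed.

Lemma many_nonroots (F : {poly k}) n : F != 0 ->
  exists s : seq k, [/\ uniq s, size s = n & forall a, a \in s -> F.[a] != 0].
Proof.
move=> F0; elim: n => [|n [s [uniq_s size_s nroot_s]]]; first by exists [::].
have : F * \prod_(z <- s) ('X - z%:P) != 0.
  by rewrite mulf_neq0 // monic_neq0 // monic_prod_XsubC.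
case/closed_nonrootP => a; rewrite rootM root_prod_XsubC negb_or => /andP[Fa sa].
exists (a :: s); split; rewrite /= ?sa ?size_s // => z.
by rewrite inE => /predU1P[->|/nroot_s].
Qed.

Lemma pigeonhole (T : eqType) (U : finType) (h : T -> U) (s : seq T) :
    uniq s -> (#|U| < size s)%N ->
  exists a a', [/\ a \in s, a' \in s, a != a' & h a = h a'].
Proof.
move=> uniq_s; apply: contraTP => none; rewrite -leqNgt -(size_map h).
have uniq_h : uniq [seq h i | i <- s].
  rewrite map_inj_in_uniq // => a a' sa sa' haa'.
  by apply/eqP/negP => /negP aa'; case: none; exists a, a'.
by rewrite -(card_uniqP uniq_h) max_card.
Qed.

(** Over an algebraically closed field a nonzero polynomial has finitely many
    divisors up to a scalar: a divisor is given by a sublist of the roots. *)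
Lemma divisor_classes (F : {poly k}) : F != 0 ->
  exists (U : finType) (rep : U -> {poly k}),
    forall s, s %| F -> exists i, s %= rep i.
Proof.
move=> F0; have [rs FE] := closed_field_poly_normal F.
exists ((size rs).-tuple bool).
exists (fun t : (size rs).-tuple bool => \prod_(z <- mask t rs) ('X - z%:P)).
move=> s; rewrite FE dvdpZr ?lead_coef_eq0 // => /dvdp_prod_XsubC[t s_t].
have [t' size_t' tE] := resize_mask t rs.
by exists (tcast size_t' (in_tuple t')); rewrite val_tcast /= -tE.
Qed.

End ClosedField.

Section FullContact.
Context (k : closedFieldType) (g m N : nat) (P Q : {poly k}).
Hypothesis g_gt0 : (0 < g)%N.
Hypothesis P_monic : P \is monic.
Hypothesis size_P : size P = (2 * g + 2)%N.
Hypothesis size_Q : (size Q <= g + 1)%N.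
Hypothesis smooth : forall a b : k, b ^+ 2 + Q.[a] * b = P.[a] ->
  (b *+ 2 + Q.[a] != 0) || (Q^`().[a] * b != P^`().[a]).
Hypothesis mN : m = g /\ N = (2 * g + 1)%N \/ m = g.+1 /\ N = (2 * g + 2)%N.
Hypothesis N0 : N%:R = 0 :> k.

Hypothesis contact : forall a b : k,
  b ^+ 2 + Q.[a] * b = P.[a] -> b *+ 2 + Q.[a] != 0 ->
  exists (r : {poly k}) (c : k), [/\ (size r <= m.+1)%N, c != 0 &
    r ^+ 2 + Q * r - P = c *: ('X - a%:P) ^+ N].

Let deriv_contact (a c : k) : (c *: ('X - a%:P) ^+ N : {poly k})^`() = 0.
Proof.
by rewrite derivZ deriv_exp -[_ *+ N]mulr_natr -(rmorph_nat polyC) N0 mulr0 scaler0.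
Qed.

(** Each a with F(a) <> 0 gives s with s^2 = F + c (T - a)^N and
    2 s s' = F'.  So s divides F', and two different points a, a' share the same
    s up to a scalar kap.  Then kap^2 = 1 because 2 s s' = F' in both cases, and
    c (T - a)^N = c' (T - a')^N, which is absurd at T = a. *)
Lemma no_full_contact_odd : 2%:R != 0 :> k -> False.
Proof.
move=> two0; pose F := 4%:R *: P + Q ^+ 2.
have four0 : 4%:R != 0 :> k by rewrite (natrM k 2 2) mulf_neq0.
have size_F : size F = (2 * g + 2)%N.
  rewrite size_polyDl size_scale // size_P.
  by rewrite (leq_ltn_trans (size_polyMleq _ _)) //; lia.
have F0 : F != 0 by rewrite -size_poly_gt0 size_F; lia.
(* If F' = 0, a root of F is the abscissa of a singular point. *)
have dF0 : F^`() != 0.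
  apply/eqP => dF; have /closed_rootP[e /eqP Fe] : size F != 1%N by lia.
  have [b b2] : exists b, b *+ 2 = - Q.[e].
    by exists (- Q.[e] / 2%:R); rewrite -[LHS]mulr_natr divfK.
  have on_e : b ^+ 2 + Q.[e] * b = P.[e].
    apply: (mulfI four0); rewrite /F !hornerE /= in Fe.
    have -> : 4%:R * (b ^+ 2 + Q.[e] * b) = (b *+ 2) ^+ 2 + (b *+ 2) * Q.[e] *+ 2.
      by ring.
    by apply/eqP; rewrite -subr_eq0 b2 -oppr_eq0 -Fe; apply/eqP; ring.
  have := smooth on_e; rewrite b2 addNr eqxx /=; move=> /eqP; apply.
  apply: (mulfI four0); have := congr1 (horner^~ e) dF.
  rewrite /F derivD derivZ expr2 derivM => E; rewrite !hornerE /= in E.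
  have -> : 4%:R * (Q^`().[e] * b) = Q^`().[e] * (b *+ 2) *+ 2 by ring.
  by apply/eqP; rewrite -subr_eq0 b2 -oppr_eq0 -E; apply/eqP; ring.
have sqrtF a : exists (s : {poly k}) c, F.[a] != 0 ->
    [/\ c != 0, s ^+ 2 = F + c *: ('X - a%:P) ^+ N & (s * s^`()) *+ 2 = F^`()].
  have [Fa|Fa] := eqVneq F.[a] 0; first by exists 0, 0.
  have [b on_a] := quadratic_root Q.[a] P.[a].
  have w0 : b *+ 2 + Q.[a] != 0.
    apply: contra_neq Fa => w0; rewrite !hornerE -on_a.
    rewrite [LHS](_ : _ = (b *+ 2 + Q.[a]) ^+ 2); first by rewrite w0 expr0n.
    by ring.
  have [r [c [_ c0 rE]]] := contact on_a w0.
  exists (r *+ 2 + Q), (4%:R * c) => _.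
  have sE : (r *+ 2 + Q) ^+ 2 = F + (4%:R * c) *: ('X - a%:P) ^+ N.
    rewrite -scalerA -rE /F -!mul_polyC !(rmorph_nat polyC); ring.
  split; [by rewrite mulf_neq0 | exact: sE |].
  have := congr1 (@deriv _) sE; rewrite derivD deriv_contact addr0 => <-.
  by rewrite deriv_exp expr1 mulrC.
have [s /choice[c sqrtFE]] := choice sqrtF.
have [U [rep repP]] := divisor_classes dF0.
have cls a : exists i, F.[a] != 0 -> s a %= rep i.
  have [i0 _] := repP _ (dvdpp _).
  have [Fa|Fa] := eqVneq F.[a] 0; first by exists i0.
  have [_ _ dvd] := sqrtFE a Fa.
  have /repP[i sai] : s a %| F^`() by rewrite -dvd -mulrnAr dvdp_mulIl.
  by exists i.
have [h hP] := choice cls.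
have [l [uniq_l size_l nroot_l]] := many_nonroots #|U|.+1 F0.
have [|a [a' [/nroot_l la /nroot_l la' aa' haa']]] := pigeonhole h uniq_l.
  by rewrite size_l.
have [ca0 sa dsa] := sqrtFE a la; have [ca'0 sa' dsa'] := sqrtFE a' la'.
have : s a %= s a'.
  by rewrite (eqp_trans (hP a la)) // haa' eqp_sym hP.
case/eqpf_eq => kap kap0 saE.
have sq1 : kap ^+ 2 = 1.
  apply/eqP; rewrite -subr_eq0; apply/eqP; move: dsa.
  rewrite saE derivZ -scalerAl -scalerAr scalerA -expr2 scalerMnr dsa'.
  move/eqP; rewrite -subr_eq0 -{2}[F^`()]scale1r -scalerBl scaler_eq0.
  by rewrite (negPf dF0) orbF => /eqP.
have : F + c a *: ('X - a%:P) ^+ N = F + c a' *: ('X - a'%:P) ^+ N.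
  by rewrite -sa -sa' saE exprZn sq1 scale1r.
move/(congr1 (horner^~ a)); rewrite !hornerE subrr expr0n.
have -> : N == 0%N = false by case: mN => -[_ ->]; rewrite ?addn1 ?addn2.
rewrite mulr0 addr0 -[LHS]addr0 => /addrI/esym/eqP.
by rewrite mulf_eq0 (negPf ca'0) /= expf_eq0 subr_eq0 (negPf aa') andbF.
Qed.

Lemma coefM_top (p q : {poly k}) i j :
  (size p <= i.+1)%N -> (size q <= j.+1)%N -> (p * q)`_(i + j) = p`_i * q`_j.
Proof.
move=> sp sq; rewrite coefM; have lt_i : (i < (i + j).+1)%N by lia.
rewrite (bigD1 (Ordinal lt_i)) //= addKn big1 ?addr0 // => l.
rewrite -val_eqE /= => ne_li; have := ltn_ord l => lt_l.
have [le_il|lt_li] := ltnP i l; first by rewrite nth_default ?mul0r // (leq_trans sp).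
by rewrite [q`__]nth_default ?mulr0 // (leq_trans sq) //; lia.
Qed.

(** Since N = 0 in k, N is even, so m = g + 1.  The top coefficients of
    (Q r)' = P' and of r^2 + Q r - P show that Q has degree g and that
    c = 1 / Q_g^2 does not depend on a.  At a root e of Q, the values r(e) (from
    Q'(e) r(e) = P'(e)) and c (e - a)^N = r(e)^2 - P(e) do not depend on a
    either, which fails for most a; and if Q'(e) = 0 then P'(e) = 0 too, so that
    the curve is singular above e. *)
Lemma no_full_contact_char2 : 2%:R = 0 :> k -> False.
Proof.
move=> two0; have add2 (x : k) : x *+ 2 = 0 by rewrite -mulr_natr two0 mulr0.
have odd1 i : (2 * i + 1)%:R = 1 :> k by rewrite natrD natrM two0 mul0r add0r.
have [mE NE] : m = g.+1 /\ N = (2 * g + 2)%N.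
  case: mN => -[_ NE] //; move: N0; rewrite NE odd1 => /eqP.
  by rewrite oner_eq0.
have P_lead : P`_(2 * g).+1 = 1.
  by move/monicP: P_monic; rewrite /lead_coef size_P addn2.
have dP0 : P^`()`_(2 * g) = 1.
  by rewrite coef_deriv P_lead -addn1 odd1.
have sing e : Q.[e] = 0 -> Q^`().[e] = 0 -> P^`().[e] = 0 -> False.
  move=> Qe dQe dPe; have [b on_e] := quadratic_root Q.[e] P.[e].
  by have := smooth on_e; rewrite Qe dQe dPe add2 addr0 mul0r eqxx.
have Q0 : Q != 0.
  apply/eqP => Q0; have /closed_rootP[e /eqP dPe] : size P^`() != 1%N.
    have le1 : (1 <= 2 * g)%N by lia.
    apply/eqP => /eq_leq/leq_sizeP/(_ _ le1)/eqP.
    by rewrite dP0 oner_eq0.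
  by apply: (sing e); rewrite ?Q0 ?deriv0 ?horner0.
have step a : Q.[a] != 0 -> exists (r : {poly k}) c, [/\ (size r <= g.+2)%N,
    r ^+ 2 + Q * r - P = c *: ('X - a%:P) ^+ N, Q^`() * r + Q * r^`() = P^`(),
    Q`_g * r`_g.+1 = 1 & c = r`_g.+1 ^+ 2].
  move=> Qa; have [b on_a] := quadratic_root Q.[a] P.[a].
  have [|r [c [size_r _ rE]]] := contact on_a; first by rewrite add2 add0r.
  rewrite mE in size_r; have size_Q' : (size Q <= g.+1)%N by rewrite -addn1.
  have dQr : Q^`() * r + Q * r^`() = P^`().
    have := congr1 (@deriv _) rE; rewrite deriv_contact !derivB derivD.
    rewrite deriv_exp derivM -mulr_natr -(rmorph_nat polyC) two0 mulr0 add0r.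
    by move/eqP; rewrite subr_eq0 => /eqP.
  exists r, c; split=> //.
    have := congr1 (fun p : {poly k} => p`_(2 * g)) dQr.
    rewrite -derivM dP0 coef_deriv -addn1 -[_ *+ _]mulr_natr odd1 mulr1 => <-.
    by rewrite -(coefM_top size_Q' size_r); congr (_`_ _); lia.
  have := congr1 (fun p : {poly k} => p`_(g.+1 + g.+1)) rE.
  rewrite coefB coefD expr2 (coefM_top size_r size_r) coefZ.
  rewrite (_ : g.+1 + g.+1 = N)%N; last by rewrite NE; lia.
  rewrite [(Q * r)`__]nth_default; last first.
    by rewrite (leq_trans (size_polyMleq _ _)) // NE; lia.
  rewrite [P`__]nth_default ?size_P ?NE // subr0 addr0 -expr2 => ->.
  have /monicP : ('X - a%:P) ^+ (2 * g + 2) \is monic by rewrite monic_exp ?monicXsubC.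
  by rewrite /lead_coef size_exp_XsubC /= => ->; rewrite mulr1.
have [a0 Qa0] := closed_nonrootP _ Q0.
have [r0 [c0 [_ _ _ lead0 _]]] := step a0 Qa0.
have Qg0 : Q`_g != 0 by apply: contra_eq_neq lead0 => ->; rewrite mul0r eq_sym oner_eq0.
have /closed_rootP[e /eqP Qe] : size Q != 1%N.
  by apply: contraNneq Qg0 => sQ; rewrite nth_default ?sQ.
have at_e a : Q.[a] != 0 -> exists2 re : k, Q^`().[e] * re = P^`().[e] &
    Q`_g ^+ 2 * (re ^+ 2 - P.[e]) = (e - a) ^+ N.
  move=> /step[r [c [_ rE dQr lead_r cE]]]; exists r.[e].
    have := congr1 (horner^~ e) dQr.
    by rewrite !hornerE Qe mul0r addr0.
  have := congr1 (horner^~ e) rE; rewrite !hornerE Qe mul0r addr0 => ->.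
  by rewrite cE mulrA -exprMn lead_r expr1n mul1r.
have [dQe|dQe] := eqVneq Q^`().[e] 0.
  have [re] := at_e _ Qa0; rewrite dQe mul0r => /esym dPe _.
  exact: (sing e).
pose v := P^`().[e] / Q^`().[e].
(* Every a with Q(a) <> 0 is a root of the nonzero polynomial G. *)
pose G := (e%:P - 'X) ^+ N - (Q`_g ^+ 2 * (v ^+ 2 - P.[e]))%:P.
have G0 : G != 0.
  rewrite -size_poly_gt0 size_polyDl -[e%:P - 'X]opprB exprNn.
    by rewrite -signr_odd size_Msign ?size_exp_XsubC.
  rewrite size_polyN -signr_odd size_Msign size_exp_XsubC NE.
  by rewrite (leq_ltn_trans (size_polyC_leq1 _)) //; lia.
have /closed_nonrootP[a] : G * Q != 0 by rewrite mulf_neq0.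
rewrite rootM negb_or => /andP[Ga Qa].
have [re dPe reE] := at_e a Qa; case/negP: Ga.
have vE : v = re by rewrite /v -dPe mulrC mulKf.
by rewrite rootE /G vE !hornerE /= reE subrr.
Qed.

Lemma no_full_contact : False.
Proof.
by have [/no_full_contact_char2|/no_full_contact_odd] := eqVneq (2%:R : k) 0.
Qed.

End FullContact.

(** * Pole orders of the Taylor numerators *)

Lemma size_polyD_bound (R : nzRingType) (p q : {poly R}) c n :
  (2 * (size p).-1 + c <= n -> 2 * (size q).-1 + c <= n ->
   2 * (size (p + q)%R).-1 + c <= n)%N.
Proof.
by have := size_polyD p q; move: (size _) (size _) (size _) => *; lia.
Qed.

Section PoleOrder.
Context (k : closedFieldType) (g : nat) (C : hyperelliptic_curve k g).
Local Notation A := (coordinate_ring C).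
Local Notation P := (curveP C).
Local Notation Q := (curveQ C).

Lemma fun_polyE u : fun_poly C u = (map_poly (fun_const C) u).[fun_x C].
Proof.
rewrite /fun_poly -{1}[u]comp_polyXr /comp_poly.
have -> : ((map_poly polyC u).['X])%:P = (map_poly (polyC \o polyC) u).['X%:P].
  by rewrite map_poly_comp horner_map.
by rewrite -(horner_map (in_qpoly (curve_eq C))) -map_poly_comp.
Qed.

Lemma coef_fun_poly u : (((fun_poly C u)`_0 = u) * ((fun_poly C u)`_1 = 0))%type.
Proof.
have uE : fun_poly C u = fun_poly C u + fun_poly C 0 * fun_y C.
  by rewrite {3}/fun_poly polyC0 rmorph0 mul0r addr0.
by rewrite uE coef_uv0 coef_uv1.
Qed.

Lemma coef_fun_y : (((fun_y C)`_0 = 0) * ((fun_y C)`_1 = 1))%type.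
Proof.
have yE : fun_y C = fun_poly C 0 + fun_poly C 1 * fun_y C.
  by rewrite /fun_poly polyC0 rmorph0 rmorph1 mul1r add0r.
by rewrite yE coef_uv0 coef_uv1.
Qed.

Lemma pole_order0 : pole_order (0 : A) = 0%N.
Proof. by rewrite /pole_order !coef0 size_poly0 eqxx. Qed.

Lemma pole_orderN (f : A) : pole_order (- f) = pole_order f.
Proof. by rewrite /pole_order !coefN !size_polyN oppr_eq0. Qed.

Lemma pole_orderD (f h : A) n :
  (pole_order f <= n)%N -> (pole_order h <= n)%N -> (pole_order (f + h)%R <= n)%N.
Proof.
have coefE i : (f + h)`_i = f`_i + h`_i by exact: coefD.
rewrite /pole_order !coefE !geq_max => /andP[fu fv] /andP[hu hv].
apply/andP; split.
  by rewrite -[X in (X <= _)%N]addn0 size_polyD_bound // addn0.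
have [f1|f1] := eqVneq f`_1 0; first by rewrite f1 add0r.
have [h1|h1] := eqVneq h`_1 0; first by rewrite h1 addr0 (negPf f1) in fv *.
by case: ifP => // _; apply: size_polyD_bound; [move: fv | move: hv];
  rewrite ?(negPf f1) ?(negPf h1).
Qed.

Lemma pole_orderM_le (f h : A) m n : (pole_order f <= m)%N ->
  (pole_order h <= n)%N -> (pole_order (f * h)%R <= m + n)%N.
Proof.
have [->|f0] := eqVneq f 0; first by rewrite mul0r pole_order0.
have [->|h0] := eqVneq h 0; first by rewrite mulr0 pole_order0.
by have [_ ->] := pole_orderM f0 h0; apply: leq_add.
Qed.

Lemma pole_orderX_le (f : A) m n : (pole_order f <= m)%N ->
  (pole_order (f ^+ n)%R <= m * n)%N.
Proof.
move=> fm; elim: n => [|n IH]; last by rewrite exprS mulnS pole_orderM_le.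
have one : 1 = fun_poly C 1 by rewrite /fun_poly rmorph1.
by rewrite expr0 one /pole_order !(coef_fun_poly 1) eqxx size_poly1.
Qed.

Lemma pole_order_poly u : pole_order (fun_poly C u) = (2 * (size u).-1)%N.
Proof. by rewrite /pole_order !(coef_fun_poly u) eqxx maxn0. Qed.

Lemma pole_order_y : pole_order (fun_y C) = (2 * g + 1)%N.
Proof. by rewrite /pole_order !coef_fun_y oner_eq0 size_poly0 size_poly1 max0n. Qed.

(** The functions E_i are the coefficients of this polynomial. *)
Definition taylor_numer (n : nat) : {poly A} :=
  numer (fun_const C) P Q (fun_x C) (fun_y C) n.

Local Notation w := (tangent_den (fun_const C) Q (fun_x C) (fun_y C)).

Lemma pole_order_tangent_den : (pole_order w <= 2 * g + 1)%N.
Proof.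
rewrite /tangent_den -fun_polyE mulr2n; apply: pole_orderD.
  by apply: pole_orderD; rewrite pole_order_y.
by rewrite pole_order_poly; have := size_curveQ C; lia.
Qed.

(** Weighted degree: T counts for a zero of order 4g, so the condition is
    stable under products.  The fixed point inherits it from the coefficients
    of [numer_step]. *)
Definition slope_bounded (Y : {poly A}) :=
  forall i, (pole_order (Y`_i)%R <= 4 * g * i)%N.

Lemma slope_boundedB Y Z :
  slope_bounded Y -> slope_bounded Z -> slope_bounded (Y - Z).
Proof.
by move=> bY bZ i; rewrite coefB; apply: pole_orderD; rewrite ?pole_orderN.
Qed.

Lemma slope_boundedM Y Z :
  slope_bounded Y -> slope_bounded Z -> slope_bounded (Y * Z).
Proof.
move=> bY bZ i; rewrite coefM; elim/big_rec: _ => [|j s _ IH].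
  by rewrite pole_order0.
apply: pole_orderD IH; have /subnKC iE : (j <= i)%N by have := ltn_ord j.
by rewrite -[X in (_ <= 4 * g * X)%N]iE mulnDr pole_orderM_le.
Qed.

Lemma pole_order_increment (u : {poly k}) d i :
  (size u <= d.+1)%N ->
  (pole_order ((increment (fun_const C) Q (fun_x C) (fun_y C) u)`_i.+1)%R
     <= 2 * (d - i.+1) + 2 * i * (2 * g + 1))%N.
Proof.
move=> size_u; rewrite coef_increment -fun_polyE; apply: pole_orderM_le.
  have : (size u^`N(i.+1) <= size u - i.+1)%N by exact: size_poly.
  move=> size_D; have := leq_trans size_D (leq_sub2r i.+1 size_u).
  by rewrite pole_order_poly; move: (size _) => z; lia.
rewrite [X in (_ <= X)%N]mulnC; apply: pole_orderX_le; exact: pole_order_tangent_den.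
Qed.

Lemma slope_boundedZ_increment (c : A) : (pole_order c <= 2 * g + 1)%N ->
  slope_bounded (c *: increment (fun_const C) Q (fun_x C) (fun_y C) Q).
Proof.
move=> bc [|i]; rewrite coefZ; first by rewrite increment0 mulr0 pole_order0.
have size_Q : (size Q <= g.+1)%N by rewrite -addn1 size_curveQ.
have [lt_ig|le_gi] := ltnP i g; last first.
  by rewrite coef_increment nderivn_poly0 ?rmorph0 ?horner0 ?mul0r ?mulr0
    ?pole_order0 // (leq_trans size_Q).
apply: leq_trans (pole_orderM_le bc (pole_order_increment i size_Q)) _.
have [d ->] : exists d, g = (i.+1 + d)%N by exists (g - i.+1)%N; rewrite subnKC.
by rewrite addKn; nia.
Qed.

Lemma slope_bounded_taylor n : slope_bounded (taylor_numer n).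
Proof.
elim: n => [|n IH]; first by move=> i; rewrite coef0 pole_order0.
have numerS : taylor_numer n.+1 = numer_step (fun_const C) P Q (fun_x C)
  (fun_y C) (taylor_numer n) by [].
rewrite numerS /numer_step expr2 [w *: (_ * _)]scalerAl.
apply: slope_boundedB; last exact: slope_boundedM.
apply: slope_boundedB; last first.
  apply: slope_boundedM IH; apply: slope_boundedZ_increment.
  exact: pole_order_tangent_den.
apply: slope_boundedB; last by apply: slope_boundedZ_increment; rewrite pole_order_y.
move=> [|i]; first by rewrite increment0 pole_order0.
have size_P : (size P <= (2 * g).+2)%N by rewrite size_curveP addn2.
have [lt_ig|le_gi] := leqP i (2 * g); last first.
  by rewrite coef_increment nderivn_poly0 ?rmorph0 ?horner0 ?mul0r
    ?pole_order0 // (leq_trans size_P).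
apply: leq_trans (pole_order_increment i size_P) _.
have [d dE] : exists d, (2 * g = i + d)%N by exists (2 * g - i)%N; rewrite subnKC.
by have -> : ((2 * g).+1 - i.+1 = d)%N; nia.
Qed.

End PoleOrder.

(** * Points with values in an algebra, and first-order deformations *)

Section Universal.
Context (k : closedFieldType) (g : nat) (C : hyperelliptic_curve k g).
Local Notation A := (coordinate_ring C).
Local Notation P := (curveP C).
Local Notation Q := (curveQ C).
Context (B : comNzRingType) (iota : {rmorphism k -> B}) (x y : B).
Hypothesis on_curve : y ^+ 2 + (map_poly iota Q).[x] * y = (map_poly iota P).[x].

(** A solution (x, y) of the curve equation in a k-algebra B is the same thing
    as a homomorphism from the coordinate ring to B. *)
Definition spec_eval (f : A) : B :=
  (map_poly iota f`_0).[x] + (map_poly iota f`_1).[x] * y.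

Lemma spec_eval_uv u v : spec_eval (fun_poly C u + fun_poly C v * fun_y C) =
  (map_poly iota u).[x] + (map_poly iota v).[x] * y.
Proof. by rewrite /spec_eval coef_uv0 coef_uv1. Qed.

Lemma spec_eval_zmod_morphism : zmod_morphism spec_eval.
Proof.
move=> f h; have coefE i : (f - h)`_i = f`_i - h`_i by exact: coefB.
by rewrite /spec_eval !coefE !rmorphB /= !hornerD !hornerN; ring.
Qed.

Lemma spec_eval_monoid_morphism : monoid_morphism spec_eval.
Proof.
split.
  have -> : 1 = fun_poly C 1 by rewrite /fun_poly rmorph1.
  by rewrite /spec_eval !coef_fun_poly rmorph1 rmorph0 horner0 mul0r addr0 hornerC.
move=> f h; rewrite coordinate_ringM spec_eval_uv.
rewrite !(rmorphB, rmorphD, rmorphM) /= !(hornerD, hornerN, hornerM).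
by rewrite -on_curve /spec_eval; ring.
Qed.

HB.instance Definition _ :=
  GRing.isZmodMorphism.Build A B spec_eval spec_eval_zmod_morphism.
HB.instance Definition _ :=
  GRing.isMonoidMorphism.Build A B spec_eval spec_eval_monoid_morphism.

Lemma coordinate_ring_hom : exists phi : {rmorphism A -> B},
  [/\ phi (fun_x C) = x, phi (fun_y C) = y & forall c, phi (fun_const C c) = iota c].
Proof.
exists spec_eval; split=> [||c] /=.
- rewrite -[fun_x C]/(fun_poly C 'X) /spec_eval !coef_fun_poly.
  by rewrite map_polyX hornerX rmorph0 horner0 mul0r addr0.
- by rewrite /spec_eval !coef_fun_y rmorph1 rmorph0 horner0 hornerC add0r mul1r.
rewrite -[fun_const C c]/(fun_poly C c%:P) /spec_eval !coef_fun_poly.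
by rewrite map_polyC hornerC rmorph0 horner0 mul0r addr0.
Qed.

End Universal.

Section HomTaylor.
Context (k : closedFieldType) (g : nat) (C : hyperelliptic_curve k g).
Local Notation A := (coordinate_ring C).
Local Notation P := (curveP C).
Local Notation Q := (curveQ C).

(** [numer_taylor] at a B-valued point of the curve.  It is used for B = k and
    for the dual numbers. *)
Lemma taylor_numer_hom (B : comNzRingType) (iota : {rmorphism k -> B})
    (phi : {rmorphism A -> B}) (n : nat) (v : B) (Z : {poly B}) :
    (forall c, phi (fun_const C c) = iota c) ->
    let x := phi (fun_x C) in
    let w := Z`_0 *+ 2 + (map_poly iota Q).[x] in
    w * v = 1 -> Z`_0 = phi (fun_y C) ->
    low n.+1 (Z ^+ 2 + (map_poly iota Q \Po ('X + x%:P)) * Z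
              - (map_poly iota P \Po ('X + x%:P))) ->
  forall i, (0 < i <= n)%N -> w ^+ (2 * i) * Z`_i = w * phi (taylor_numer C n)`_i.
Proof.
move=> phi_const x w; rewrite {}/w => + Z0; rewrite Z0 => wv lowZ i i_n.
have mapE u : map_poly (phi \o fun_const C) u = map_poly iota u.
  by apply: eq_map_poly => c /=.
rewrite -coef_map map_numer -/x -[map_poly iota Q]mapE.
apply: (@numer_taylor _ _ (phi \o fun_const C : {rmorphism k -> B}) P Q x
  (phi (fun_y C)) n v Z) => //; first by rewrite /tangent_den mapE.
by rewrite !mapE.
Qed.

Section AtPoint.
Variable p : affine_point C.
Local Notation a := (val p).1.
Local Notation b := (val p).2.
Local Notation w := (b *+ 2 + Q.[a]).
Local Notation shift u := (u \Po ('X + a%:P)).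
Local Notation branch n Z :=
  (low n (Z ^+ 2 + shift Q * Z - shift P : {poly k})).

Lemma on_curveP : b ^+ 2 + Q.[a] * b = P.[a].
Proof. exact/eqP/(valP p). Qed.

Lemma shift0 (u : {poly k}) : (shift u)`_0 = u.[a].
Proof. by rewrite coef_comp_shift nderivn0. Qed.

Lemma taylor_numer_at n (Z : {poly k}) : w != 0 -> Z`_0 = b -> branch n.+1 Z ->
  forall i, (0 < i <= n)%N ->
    w ^+ (2 * i) * Z`_i = w * fun_eval p (taylor_numer C n)`_i.
Proof.
move=> w0 Z0 lowZ i i_n.
have x_p : fun_eval p (fun_x C) = a.
  by rewrite -[fun_x C]/(fun_poly C 'X) fun_eval_poly hornerX.
have mapE (u : {poly k}) : map_poly idfun u = u by apply: map_poly_id.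
have := @taylor_numer_hom k idfun (fun_eval p) n w^-1 Z.
rewrite /= !mapE x_p fun_eval_y Z0 mulfV //; apply=> //.
exact: fun_const_eval.
Qed.

Lemma branch_exists n : w != 0 -> exists Z : {poly k}, Z`_0 = b /\ branch n.+1 Z.
Proof. by move=> w0; apply: hensel; rewrite !shift0 // on_curveP. Qed.

Local Notation dual := {poly %/ 'X^2 : {poly k}}.
Local Notation toD := (in_qpoly ('X^2 : {poly k})).

Lemma mk_monicX2 : mk_monic ('X^2 : {poly k}) = 'X^2.
Proof. by rewrite /mk_monic size_polyXn monicXn. Qed.

Lemma dual_eq0 (f : {poly k}) : toD f = 0 <-> low 2 f.
Proof.
split=> [f0|lowf]; last first.
  have fE : f = drop_poly 2 f * 'X^2.
    rewrite -[LHS](poly_take_drop 2) (_ : take_poly 2 f = 0) ?add0r //.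
    apply/polyP => i; rewrite coef_take_poly coef0.
    by case: ifP => // lt_i; apply: lowf.
  apply/val_inj; rewrite /= mk_monicX2 fE.
  by rewrite Pdiv.RingMonic.rmodp_mull ?monicXn.
move=> i lt_i; have /(congr1 val) /= : toD f = 0 by [].
rewrite mk_monicX2 => rem0.
rewrite (Pdiv.RingMonic.rdivp_eq (monicXn _ 2) f) rem0 addr0.
by rewrite coefMXn lt_i.
Qed.

Lemma dual_unit (D : {poly k}) : D`_0 != 0 -> exists v, toD D * v = 1.
Proof.
move=> D0; pose e := (D`_0)^-1; have e0 : D`_0 * e = 1 by rewrite mulfV.
exists (toD (e%:P - (D`_1 * e ^+ 2) *: 'X)); rewrite -rmorphM.
apply/eqP; rewrite -subr_eq0 -(rmorph1 toD) -rmorphB; apply/eqP/dual_eq0.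
move=> [|[|//]] _; rewrite coefB coefM !big_ord_recr big_ord0 /= !add0r.
  by rewrite coefB coefC coefZ coefX coef1 mulr0 subr0 /= e0 subrr.
rewrite !coefB !coefC !coefZ !coefX /= !subr0 mulr0 subr0 mulr1 sub0r.
rewrite [LHS](_ : _ = D`_1 * e * (1 - D`_0 * e)); last by ring.
by rewrite e0 subrr mulr0.
Qed.

(** If E_i vanishes identically, its value at the point
    (a + epsilon, Z(epsilon)) of the curve over the dual numbers vanishes too.
    The branch through that point is Z(T + epsilon), whose i-th coefficient is
    Z_i + (i + 1) Z_(i+1) epsilon. *)
Lemma taylor_numer_deriv n i (Z : {poly k}) :
    w != 0 -> Z`_0 = b -> branch n.+2 Z -> (0 < i <= n)%N ->
    (taylor_numer C n)`_i = 0 ->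
  Z`_i.+1 *+ i.+1 = 0.
Proof.
move=> w0 Z0 lowZ i_n numer0.
pose iota : {rmorphism k -> dual} := toD \o polyC.
pose x := toD ('X + a%:P).
have hornerE u : (map_poly iota u).[x] = toD (shift u).
  rewrite /comp_poly -(horner_map toD). by rewrite -map_poly_comp.
have on_x : toD Z ^+ 2 + (map_poly iota Q).[x] * toD Z = (map_poly iota P).[x].
  apply/eqP; rewrite -subr_eq0 !hornerE -rmorphXn -rmorphM -rmorphD -rmorphB /=.
  by apply/eqP/dual_eq0; apply: low_le lowZ.
have [phi [phi_x phi_y phi_const]] := coordinate_ring_hom on_x.
(* The coefficients of u(T + epsilon), computed in k[epsilon][T]. *)
pose spread (u : {poly k}) : {poly dual} :=
  map_poly toD (map_poly polyC u \Po ('X + 'X%:P)).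
have coef_spread u j : (spread u)`_j = toD u^`N(j).
  rewrite coef_map /= coef_comp_shift nderivn_map.
  by rewrite -[_.['X]]/(u^`N(j) \Po 'X) comp_polyXr.
have spread_shift u : spread (shift u) = map_poly iota u \Po ('X + x%:P).
  rewrite /spread [map_poly polyC _]map_comp_poly -comp_polyA [LHS]map_comp_poly.
  rewrite -map_poly_comp.
  congr (_ \Po _).
  rewrite [map_poly polyC _]rmorphD /= map_polyX map_polyC /= comp_polyD.
  rewrite comp_polyX comp_polyC !rmorphD /= map_polyX !map_polyC /= -addrA.
  by rewrite -polyCD -rmorphD.
have [|v wvD] := @dual_unit (Z *+ 2 + shift Q).
  by rewrite coefD coefMn Z0 shift0.
have wv : ((spread Z)`_0 *+ 2 + (map_poly iota Q).[x]) * v = 1.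
  by rewrite coef_spread nderivn0 hornerE -rmorphMn -rmorphD.
have phiZ0 : (spread Z)`_0 = phi (fun_y C) by rewrite phi_y coef_spread nderivn0.
have := taylor_numer_hom phi_const; rewrite phi_x => /(_ n v (spread Z) wv phiZ0).
have lowB : low n.+1 (spread Z ^+ 2 + (map_poly iota Q \Po ('X + x%:P)) * spread Z
    - (map_poly iota P \Po ('X + x%:P))).
  rewrite -!spread_shift.
  have -> : spread Z ^+ 2 + spread (shift Q) * spread Z - spread (shift P) =
      spread (Z ^+ 2 + shift Q * Z - shift P).
    by rewrite /spread -!(rmorphM, rmorphXn, rmorphB, rmorphD).
  move=> j lt_j; rewrite coef_spread; apply/dual_eq0 => l lt_l.
  by rewrite coef_nderivn lowZ ?mul0rn //; lia.
move=> /(_ lowB i i_n); rewrite numer0 rmorph0 mulr0.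
move=> /(congr1 ( *%R (v ^+ (2 * i)))).
rewrite mulr0 mulrA -exprMn [v * _]mulrC wv expr1n mul1r coef_spread.
move/dual_eq0/(_ 1%N isT); rewrite coef_nderivn addn1.
by rewrite binSn.
Qed.

End AtPoint.
End HomTaylor.

(** * Contact and vanishing of the Taylor numerators *)

Section Contact.
Context (k : closedFieldType) (g : nat) (C : hyperelliptic_curve k g).
Local Notation A := (coordinate_ring C).
Local Notation P := (curveP C).
Local Notation Q := (curveQ C).
Variable m : nat.
Hypothesis m_g : m = g \/ m = g.+1.
Local Notation N := (m + g).+1.

Section AtPoint.
Variable p : affine_point C.
Local Notation a := (val p).1.
Local Notation b := (val p).2.
Local Notation w := (b *+ 2 + Q.[a]).
Local Notation shift u := (u \Po ('X + a%:P)).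

Lemma size_shift (c : k) (u : {poly k}) : size (u \Po ('X + c%:P)) = size u.
Proof. by rewrite size_comp_poly2 // size_XaddC. Qed.

(** The polynomial r(a + T) is itself a branch modulo T^N, and its coefficients
    beyond degree m are zero. *)
Lemma taylor_numer_contact (r : {poly k}) (c : k) :
    w != 0 -> (size r <= m.+1)%N -> r.[a] = b ->
    r ^+ 2 + Q * r - P = c *: ('X - a%:P) ^+ N ->
  forall i, (m < i <= m + g)%N ->
    fun_eval p (taylor_numer C (m + g))`_i = 0.
Proof.
move=> w0 size_r ra rE i /andP[lt_mi le_i].
have i_n : (0 < i <= m + g)%N by rewrite le_i (leq_ltn_trans _ lt_mi).
have lowr : low N (shift r ^+ 2 + shift Q * shift r - shift P : {poly k}).
  have -> : shift r ^+ 2 + shift Q * shift r - shift P = shift (r ^+ 2 + Q * r - P).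
    by rewrite -!(rmorphM, rmorphXn, rmorphD, rmorphB).
  move=> j lt_j; rewrite rE comp_polyZ rmorphXn /= comp_polyB comp_polyX comp_polyC.
  by rewrite addrK coefZ coefXn ltn_eqF // mulr0.
have r0 : (shift r)`_0 = b by rewrite shift0.
have := taylor_numer_at w0 r0 lowr i_n.
rewrite [(shift r)`_i]nth_default ?mulr0 ?size_shift ?(leq_trans size_r) //.
by move/esym/eqP; rewrite mulf_eq0 (negPf w0) => /eqP.
Qed.

Hypothesis taylor0 : forall i, (m < i <= m + g)%N -> (taylor_numer C (m + g))`_i = 0.

(** Truncating the branch Z at degree m changes nothing below degree N, so the
    truncation r satisfies the curve equation modulo (T - a)^N; and
    r^2 + Q r - P has degree at most N, which leaves a multiple c (T - a)^N.
    In degree N one reads c + w Z_N = 0, so Z_N <> 0, while N Z_N = 0 by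
    [taylor_numer_deriv]. *)
Lemma contact_of_taylor : (0 < g)%N -> w != 0 ->
  N%:R = 0 :> k /\
  exists (r : {poly k}) (c : k), [/\ (size r <= m.+1)%N, c != 0 &
    r ^+ 2 + Q * r - P = c *: ('X - a%:P) ^+ N].
Proof.
move=> g_gt0 w0; have [Z [Z0 lowZ]] := branch_exists N w0.
have Zi0 i : (m < i <= m + g)%N -> Z`_i = 0.
  move=> i_m; have i_n : (0 < i <= m + g)%N by lia.
  have := taylor_numer_at w0 Z0 (low_le _ lowZ) i_n.
  rewrite taylor0 // rmorph0 mulr0 => /(_ (leqnSn _))/eqP.
  by rewrite mulf_eq0 expf_eq0 (negPf w0) andbF => /eqP.
pose R := take_poly m.+1 Z.
have lowD : low N (Z - R).
  move=> i lt_i; rewrite coefB coef_take_poly ltnS.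
  by case: leqP => [|lt_mi]; rewrite ?subrr // Zi0 ?subr0 // lt_mi.
pose G := R ^+ 2 + shift Q * R - shift P.
have GE : Z ^+ 2 + shift Q * Z - shift P = G + (Z - R) * (Z + R + shift Q).
  by rewrite /G; ring.
have lowG : low N G.
  have -> : G = (Z ^+ 2 + shift Q * Z - shift P) - (Z + R + shift Q) * (Z - R).
    by rewrite GE mulrC addrK.
  by apply: lowB; [apply: low_le lowZ | apply: lowMl].
have shiftK (u : {poly k}) : shift u \Po ('X - a%:P) = u.
  by rewrite -comp_polyA comp_polyD comp_polyX comp_polyC subrK comp_polyXr.
pose r := R \Po ('X - a%:P).
have size_r : (size r <= m.+1)%N.
  by rewrite /r -polyCN size_shift size_take_poly.
have rE : r ^+ 2 + Q * r - P = G \Po ('X - a%:P).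
  by rewrite /G comp_polyB comp_polyD rmorphXn comp_polyM /= !shiftK.
have size_G : (0 < size G <= N.+1)%N.
  rewrite -(size_shift (- a)) polyCN -rE.
  have -> : r ^+ 2 + Q * r - P = (- r) ^+ 2 - (- r) * 1 * Q - 1 ^+ 2 * P by ring.
  rewrite (@size_norm_form _ g) ?size_curveP ?size_curveQ //; last first.
    by apply/negP => /eqP[_ /eqP]; rewrite oner_eq0.
  rewrite oner_eq0 size_poly1 size_polyN.
  by move: m_g size_r; move: (size r) => z; clear; lia.
have GN : G = G`_N *: 'X^N.
  apply/polyP => i; rewrite coefZ coefXn.
  have [lt_i|lt_i|->] := ltngtP i N; rewrite ?mulr1 // mulr0; first exact: lowG.
  by rewrite nth_default // (leq_trans _ lt_i) //; case/andP: size_G.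
have c0 : G`_N != 0.
  apply/eqP => c0; case/andP: size_G; rewrite size_poly_gt0 => /negP[].
  by rewrite GN c0 scale0r.
split; last first.
  exists r, G`_N; split=> //.
  by rewrite rE {1}GN comp_polyZ rmorphXn /= comp_polyX.
have R0 : R`_0 = b by rewrite coef_take_poly.
have RN : R`_N = 0 by rewrite coef_take_poly ltnS leqNgt ltnS leq_addr.
have ZN : Z`_N != 0.
  apply: contra_neq c0 => ZN0.
  have ZRN : (Z - R)`_N = 0 by rewrite coefB ZN0 RN subr0.
  have := lowZ _ (ltnSn N); rewrite GE coefD coefM big_ord_recr /= subnn.
  rewrite big1 => [|i _]; last by rewrite lowD ?mul0r.
  by rewrite ZRN mul0r !addr0.
have mg_gt0 : (0 < m + g <= m + g)%N by lia.
have top0 : (taylor_numer C (m + g))`_(m + g) = 0.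
  by apply: taylor0; rewrite leqnn andbT -[X in (X < _)%N]addn0 ltn_add2l.
have := taylor_numer_deriv w0 Z0 lowZ mg_gt0 top0.
by rewrite -[LHS]mulr_natr => /eqP; rewrite mulf_eq0 (negPf ZN) => /eqP.
Qed.

End AtPoint.
End Contact.

(** * Orders at affine points *)

Section LocalParameter.
Context (k : fieldType) (A : comNzRingType) (ev : {rmorphism A -> k}).
Implicit Types (I : nat -> A -> Prop) (t f h : A).

Definition exact_order I n f := I n f /\ ~ I n.+1 f.

(** The filtration I is the one given by the powers of t after inverting the
    functions that do not vanish at the point. *)
Definition local_parameter t I :=
  [/\ ev t = 0, forall f, t * f = 0 -> f = 0,
      forall n f, I n f <-> exists s h, ev s != 0 /\ s * f = t ^+ n * h
    & forall n f, exact_order I n f <->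
        exists s h, [/\ ev s != 0, ev h != 0 & s * f = t ^+ n * h]].

Context (t : A) (I : nat -> A -> Prop) (tI : local_parameter t I).

Lemma parameter_exp_inj n f h : t ^+ n * f = t ^+ n * h -> f = h.
Proof.
case: tI => _ t_reg _ _.
move/eqP; rewrite -subr_eq0 -mulrBr => /eqP tfh; apply/eqP; rewrite -subr_eq0.
apply/eqP; elim: n tfh => [|n IH]; first by rewrite mul1r.
by rewrite exprS -mulrA => /t_reg /IH.
Qed.

Lemma order_geM m n f h : I m f -> I n h -> I (m + n)%N (f * h).
Proof.
case: tI => _ _ tE _ /tE[s [f' [s0 sf]]] /tE[r [h' [r0 rh]]]; apply/tE.
exists (s * r), (f' * h'); rewrite rmorphM mulf_neq0 //; split=> //.
by rewrite mulrACA sf rh exprD; ring.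
Qed.

Lemma order_ge_le m n f : (m <= n)%N -> I n f -> I m f.
Proof.
case: tI => _ _ tE _ le_mn /tE[s [h [s0 sf]]]; apply/tE; exists s, (t ^+ (n - m) * h).
by split=> //; rewrite sf mulrA -exprD subnKC.
Qed.

Lemma order_ge0 f : I 0 f.
Proof.
by case: tI => _ _ tE _; apply/tE; exists 1, f; rewrite rmorph1 oner_neq0.
Qed.

Lemma order_ge1 f : I 1%N f <-> ev f = 0.
Proof.
case: tI => t0 _ tE texE; split=> [/tE[s [h [s0 sf]]]|f0].
  have /eqP := congr1 ev sf; rewrite !rmorphM rmorphXn /= t0 mul0r mulf_eq0.
  by rewrite (negPf s0) => /eqP.
apply: contrapT => nIf; have /texE[s [h [s0 h0 sf]]] : exact_order I 0 f.
  by split=> //; apply: order_ge0.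
have /eqP := congr1 ev sf; rewrite mul1r rmorphM /= f0 mulr0 eq_sym.
by rewrite (negPf h0).
Qed.

Lemma exact_order0 f : ev f != 0 -> exact_order I 0 f.
Proof.
by move=> f0; split; [exact: order_ge0 | move/order_ge1/eqP; rewrite (negPf f0)].
Qed.

Lemma exact_order_uniq m n f : exact_order I m f -> exact_order I n f -> m = n.
Proof.
move=> [Im nIm] [In nIn]; have [lt_mn|lt_nm|//] := ltngtP m n.
  by case: nIm; apply: order_ge_le In.
by case: nIn; apply: order_ge_le Im.
Qed.

Lemma exact_orderM m n f h :
  exact_order I m f -> exact_order I n h -> exact_order I (m + n) (f * h).
Proof.
case: tI => _ _ _ tE /tE[s [f' [s0 f'0 sf]]] /tE[r [h' [r0 h'0 rh]]]; apply/tE.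
exists (s * r), (f' * h'); rewrite !rmorphM !mulf_neq0 //; split=> //.
by rewrite mulrACA sf rh exprD; ring.
Qed.

Lemma order_ge_cancel m n f h :
  exact_order I m f -> I (m + n)%N (f * h) -> I n h.
Proof.
case: tI => _ _ tE texE /texE[s [f' [s0 f'0 sf]]] /tE[r [h' [r0 rh]]]; apply/tE.
exists (r * f'), (s * h'); rewrite rmorphM mulf_neq0 //; split=> //.
apply: (@parameter_exp_inj m).
have -> : t ^+ m * (r * f' * h) = r * (t ^+ m * f') * h by ring.
rewrite -sf (_ : r * (s * f) * h = s * (r * (f * h))); last by ring.
by rewrite rh exprD; ring.
Qed.

End LocalParameter.

(** The curve equation near a point (a, b) with 2b + Q(a) = 0; here c, r, q
    stand for Q(a), (P - P(a)) / X and (Q - Q(a)) / X. *)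
Lemma ramified_identity (A : comNzRingType) (y b c r q X : A) :
  y ^+ 2 = (b ^+ 2 + c * b + r * X) - (c + q * X) * y -> b *+ 2 + c = 0 ->
  (y - b) ^+ 2 = (r - q * y) * X.
Proof.
move=> yE /eqP; rewrite addrC addr_eq0 => /eqP cE.
have -> : (y - b) ^+ 2 = y ^+ 2 - b * y *+ 2 + b ^+ 2 by ring.
by rewrite yE cE; ring.
Qed.

Section Curve.
Context (k : closedFieldType) (g : nat) (C : hyperelliptic_curve k g).
Local Notation A := (coordinate_ring C).
Local Notation P := (curveP C).
Local Notation Q := (curveQ C).

Section AtPoint.
Variable p : affine_point C.
Local Notation a := (val p).1.
Local Notation b := (val p).2.
Local Notation w := (b *+ 2 + Q.[a]).
Local Notation X := (fun_x C - fun_const C a).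
Local Notation Y := (fun_y C - fun_const C b).

Lemma local_parameter_x : w != 0 -> local_parameter (fun_eval p) X (in_max_ideal_pow p).
Proof.
move=> w0; have [u [v [uv eu _]]] := fun_tangent p.
have u0 : fun_eval p u != 0 by rewrite eu.
have X_reg : forall f, X * f = 0 -> f = 0 := @fun_X_reg _ _ _ p.
have tXY : X = X /\ Y = Y \/ X = Y /\ Y = X by left.
split; [exact: fun_eval_X | exact: X_reg | |].
  exact: (idpowP (@fun_const_eval _ _ _ p) (@fun_eval_ker _ _ _ p)
    (fun_eval_X p) tXY u0 uv).
exact: (idpow_ordP (@fun_const_eval _ _ _ p) (@fun_eval_ker _ _ _ p)
    (fun_eval_X p) tXY u0 uv X_reg).
Qed.

Lemma local_parameter_y : w = 0 -> local_parameter (fun_eval p) Y (in_max_ideal_pow p).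
Proof.
move=> w0; have [u [v [uv _ eqv]]] := fun_tangent p.
have v0 : fun_eval p v != 0.
  have := curve_smooth (on_curveP p).
  by rewrite w0 eqxx /= eqv subr_eq0 eq_sym.
have Y_reg : forall f, Y * f = 0 -> f = 0 := @fun_Y_reg _ _ _ p.
have tXY : Y = X /\ X = Y \/ Y = Y /\ X = X by right.
have vu : v * X = u * Y by rewrite uv.
split; [exact: fun_eval_Y | exact: Y_reg | |].
  exact: (idpowP (@fun_const_eval _ _ _ p) (@fun_eval_ker _ _ _ p)
    (fun_eval_Y p) tXY v0 vu).
exact: (idpow_ordP (@fun_const_eval _ _ _ p) (@fun_eval_ker _ _ _ p)
    (fun_eval_Y p) tXY v0 vu Y_reg).
Qed.

Lemma local_parameter_exists :
  exists t, local_parameter (fun_eval p) t (in_max_ideal_pow p).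
Proof.
have [/local_parameter_y|/local_parameter_x] := eqVneq w 0; first by exists Y.
by exists X.
Qed.

Lemma fun_X_order1 : w != 0 -> exact_order (in_max_ideal_pow p) 1 X.
Proof.
move=> w0; have [_ _ _ tE] := local_parameter_x w0; apply/tE.
by exists 1, 1; rewrite rmorph1 oner_neq0 mul1r mulr1.
Qed.

End AtPoint.
End Curve.

Section Curve.
Context (k : closedFieldType) (g : nat) (C : hyperelliptic_curve k g).
Local Notation A := (coordinate_ring C).
Local Notation P := (curveP C).
Local Notation Q := (curveQ C).
Section AtPoint.
Variable p : affine_point C.
Local Notation a := (val p).1.
Local Notation b := (val p).2.
Local Notation w := (b *+ 2 + Q.[a]).
Local Notation X := (fun_x C - fun_const C a).
Local Notation Y := (fun_y C - fun_const C b).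

Lemma ramified_eq : w = 0 -> exists s, Y ^+ 2 = s * X /\ fun_eval p s != 0.
Proof.
move=> w0; have [q [qE qa]] := fun_poly_sub p Q; have [r [rE ra]] := fun_poly_sub p P.
exists (fun_poly C r - fun_poly C q * fun_y C); split; last first.
  rewrite rmorphB rmorphM /= fun_eval_y !fun_eval_poly ra qa subr_eq0.
  by have := curve_smooth (on_curveP p); rewrite w0 eqxx /= eq_sym.
have subE u v : u - u.[a]%:P = v * ('X - a%:P) ->
    fun_poly C u = fun_const C u.[a] + fun_poly C v * X.
  move=> uE; rewrite -(fun_X p) -fun_polyM -uE.
  by rewrite -[fun_const C _]/(fun_poly C u.[a]%:P) -fun_polyD addrC subrK.
apply: (@ramified_identity A _ _ (fun_const C Q.[a])).
  have -> : fun_const C b ^+ 2 + fun_const C Q.[a] * fun_const C b =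
      fun_const C P.[a] by rewrite -on_curveP rmorphD rmorphXn rmorphM.
  by rewrite -(subE _ _ qE) -(subE _ _ rE) curve_eqE.
by rewrite -rmorphMn -rmorphD w0 rmorph0.
Qed.


Lemma fun_X_order2 : w = 0 -> exact_order (in_max_ideal_pow p) 2 X.
Proof.
move=> w0; have [_ _ _ tE] := local_parameter_y w0; apply/tE.
have [s [Y2 s0]] := ramified_eq w0.
by exists s, 1; rewrite rmorph1 oner_neq0 mulr1 Y2.
Qed.

Lemma fun_X_order : exists i, exact_order (in_max_ideal_pow p) i.+1 X /\
  (w = 0 -> (0 < i)%N).
Proof.
have [w0|w0] := eqVneq w 0; first by exists 1%N; split=> //; apply: fun_X_order2.
exists 0%N; split; first exact: fun_X_order1.
by move/eqP; rewrite (negPf w0).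
Qed.

Lemma fun_poly_order u : u != 0 ->
  exists j, exact_order (in_max_ideal_pow p) j (fun_poly C u).
Proof.
have [t tI] := local_parameter_exists p.
have [n] := ubnP (size u); elim: n u => // n IH u lt_u u0.
have [|ua] := boolP (root u a); last first.
  by exists 0%N; apply: (exact_order0 tI); rewrite /= fun_eval_poly.
case/factor_theorem => v uE; have v0 : v != 0.
  by apply: contra_neq u0 => v0; rewrite uE v0 mul0r.
have [|j jv] := IH v _ v0.
  by move: lt_u; rewrite uE size_Mmonic ?monicXsubC // size_XsubC addn2.
have [i [iX _]] := fun_X_order.
exists (j + i.+1)%N; rewrite uE fun_polyM fun_X.
exact: (exact_orderM tI).
Qed.

Lemma cnorm_eval (f : A) : (cnorm f).[a] =
  fun_eval p f * ((f`_0).[a] + (f`_1).[a] * (- Q.[a] - b)).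
Proof.
by rewrite /cnorm /fun_eval !hornerE /= -(on_curveP p); ring.
Qed.

End AtPoint.

Definition fun_conj (f : A) : A :=
  fun_poly C (f`_0 - f`_1 * Q) + fun_poly C (- f`_1) * fun_y C.

Lemma fun_conjM f : f * fun_conj f = fun_poly C (cnorm f).
Proof.
rewrite coordinate_ringM !coef_uv0 !coef_uv1.
rewrite [X in _ + fun_poly C X * _](_ : _ = 0); last by ring.
rewrite {2}/fun_poly polyC0 rmorph0 mul0r addr0; congr fun_poly.
by rewrite /cnorm; ring.
Qed.

Lemma fun_mulf_eq0 (f h : A) : f * h = 0 -> f = 0 \/ h = 0.
Proof.
have [-> //|f0] := eqVneq f 0; first by left.
have [-> //|h0] := eqVneq h 0; first by right.
by have [fh _] := pole_orderM f0 h0 => fh0; rewrite fh0 eqxx in fh.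
Qed.

Lemma cnorm_neq0 (f : A) : f != 0 -> cnorm f != 0.
Proof. by move=> f0; rewrite -size_poly_gt0 size_cnorm. Qed.

Lemma fun_conj_neq0 (f : A) : f != 0 -> fun_conj f != 0.
Proof.
move=> f0; apply: contra_neq (cnorm_neq0 f0) => fc0.
have := fun_conjM f; rewrite fc0 mulr0 => /(congr1 (fun h : A => h`_0)).
by rewrite coef_fun_poly coef0.
Qed.

(** The order of f is bounded by that of its norm, which is a polynomial in x. *)
Lemma exact_order_exists (p : affine_point C) (f : A) : f != 0 ->
  exists n, exact_order (in_max_ideal_pow p) n f.
Proof.
move=> f0; have [t tI] := local_parameter_exists p.
have [J Jn] := fun_poly_order p (cnorm_neq0 f0).
apply: contrapT => none; case: (Jn) => _; apply; rewrite -fun_conjM.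
rewrite -[J.+1]addn0; apply: (order_geM tI); last exact: order_ge0 tI _.
elim: J.+1 => [|n IH]; first exact: order_ge0 tI _.
by apply: contrapT => nI; apply: none; exists n.
Qed.

Definition mk_point e c (on_e : c ^+ 2 + Q.[e] * c = P.[e]) : affine_point C :=
  exist _ (e, c) (introT eqP on_e).

Lemma conj_on_curve e c : c ^+ 2 + Q.[e] * c = P.[e] ->
  (- Q.[e] - c) ^+ 2 + Q.[e] * (- Q.[e] - c) = P.[e].
Proof. by move=> <-; ring. Qed.

Lemma ideal_sq_ramified (R : comNzRingType) (X Y s : R) (c : nat -> R) :
  Y ^+ 2 = s * X -> exists d, \sum_(i < 3) c i * X ^+ i * Y ^+ (2 - i) = X * d.
Proof.
move=> Y2; exists (c 0%N * s + c 1%N * Y + c 2%N * X).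
by rewrite !big_ord_recr big_ord0 /= Y2; ring.
Qed.

(** For f = u + v y the claim is u(e) = v(e) = 0.  If there are two points
    above e this follows from the vanishing of f at both; if there is only one,
    f is in the square of its maximal ideal, which is contained in (x - e). *)
Lemma fun_X_dvd (e : k) (f : A) :
  (forall (p : affine_point C) j, (val p).1 = e ->
     exact_order (in_max_ideal_pow p) j (fun_poly C ('X - e%:P)) ->
     in_max_ideal_pow p j f) ->
  exists f', f = fun_poly C ('X - e%:P) * f'.
Proof.
move=> f_ge; have [c on_e] := quadratic_root Q.[e] P.[e].
pose p := mk_point on_e; have [w0|w0] := eqVneq (c *+ 2 + Q.[e]) 0.
  have [i [iX i_gt0]] := fun_X_order p.
  have [t tI] := local_parameter_exists p.
  have [d fE] : in_max_ideal_pow p 2 f.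
    apply: (order_ge_le tI) (f_ge p i.+1 _ _) => //; first exact: i_gt0.
    by rewrite (fun_X p).
  have [s [Y2 _]] := ramified_eq (p := p) w0.
  have [f' f'E] := ideal_sq_ramified d Y2; exists f'.
  by rewrite fE f'E (fun_X p).
pose p' := mk_point (conj_on_curve on_e).
have zero (q : affine_point C) : (val q).1 = e -> fun_eval q f = 0.
  move=> qe; have [t tI] := local_parameter_exists q.
  have [i [iX _]] := fun_X_order q; apply/(order_ge1 tI).
  apply: (order_ge_le tI) (f_ge q i.+1 _ _) => //.
  by rewrite -qe (fun_X q).
have := zero p erefl; have := zero p' erefl; rewrite /fun_eval /= => z' z.
have f1e : (f`_1).[e] = 0.
  apply/eqP; rewrite -[_ == 0]orbF -(negPf w0) -mulf_eq0.
  rewrite [X in X == _](_ : _ = ((f`_0).[e] + (f`_1).[e] * c) -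
    ((f`_0).[e] + (f`_1).[e] * (- Q.[e] - c))); last by ring.
  by rewrite z z' subrr.
have f0e : (f`_0).[e] = 0 by move: z; rewrite f1e mul0r addr0.
have /factor_theorem[q0 q0E] : root f`_0 e by rewrite rootE f0e.
have /factor_theorem[q1 q1E] : root f`_1 e by rewrite rootE f1e.
exists (fun_poly C q0 + fun_poly C q1 * fun_y C).
rewrite [LHS]coordinate_ringE q0E q1E !fun_polyM mulrDr mulrA.
by rewrite [fun_poly C q0 * _]mulrC [fun_poly C q1 * _]mulrC.
Qed.

Lemma fun_poly_dvd (u : {poly k}) (f : A) : u != 0 ->
  (forall (p : affine_point C) j,
     exact_order (in_max_ideal_pow p) j (fun_poly C u) ->
     in_max_ideal_pow p j f) ->
  exists f', f = fun_poly C u * f'.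
Proof.
have [n] := ubnP (size u); elim: n u f => // n IH u f lt_u u0 f_ge.
have [/eqP size_u|/closed_rootP[e]] := boolP (size u == 1%N).
  have [c c0 uE] : exists2 c, c != 0 & u = c%:P by apply/size_poly1P; rewrite size_u.
  exists (fun_poly C (c^-1)%:P * f).
  by rewrite mulrA -fun_polyM uE -polyCM mulfV // /fun_poly rmorph1 mul1r.
case/factor_theorem => v uE.
have v0 : v != 0 by apply: contra_neq u0 => v0; rewrite uE v0 mul0r.
have Xe0 : 'X - e%:P != 0 :> {poly k} by rewrite polyXsubC_eq0.
have [f' f'E] : exists f', f = fun_poly C ('X - e%:P) * f'.
  apply: fun_X_dvd => p j _ jX; have [t tI] := local_parameter_exists p.
  have [i iv] := fun_poly_order p v0.
  apply: (order_ge_le tI) (f_ge p (i + j)%N _); first exact: leq_addl.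
  by rewrite uE fun_polyM; apply: (exact_orderM tI).
have [||f'' f''E] := IH v f' _ v0.
- by move: lt_u; rewrite uE size_Mmonic ?monicXsubC // size_XsubC addn2.
- move=> p j jv; have [t tI] := local_parameter_exists p.
  have [i iX] := fun_poly_order p Xe0.
  apply: (order_ge_cancel tI iX); rewrite -f'E; apply: f_ge.
  by rewrite uE mulrC fun_polyM; apply: (exact_orderM tI).
by exists f''; rewrite f'E f''E mulrA -fun_polyM uE [v * _]mulrC.
Qed.

(** The affine curve is normal: a fraction f / h without poles is regular.
    Multiplying by the conjugate of h makes the denominator a polynomial in x,
    which is then cancelled one root at a time. *)
Lemma quotient_regular (f h : A) : f != 0 -> h != 0 ->
  (forall (p : affine_point C) m n, exact_order (in_max_ideal_pow p) m f ->
     exact_order (in_max_ideal_pow p) n h -> (n <= m)%N) ->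
  exists s, f = h * s.
Proof.
move=> f0 h0 le_ord; have hc0 := fun_conj_neq0 h0.
have [|s sE] := @fun_poly_dvd (cnorm h) (f * fun_conj h) (cnorm_neq0 h0).
  move=> p j; rewrite -fun_conjM => jn; have [t tI] := local_parameter_exists p.
  have [m mf] := exact_order_exists p f0; have [n nh] := exact_order_exists p h0.
  have [i ic] := exact_order_exists p hc0.
  have -> := exact_order_uniq tI jn (exact_orderM tI nh ic).
  apply: (order_ge_le tI) (order_geM tI (proj1 mf) (proj1 ic)).
  by rewrite leq_add2r; apply: le_ord mf nh.
exists s; have [||/eqP] := @fun_mulf_eq0 (f - h * s) (fun_conj h); last first.
- by rewrite (negPf hc0).
- by move/eqP; rewrite subr_eq0 => /eqP.
by rewrite mulrBl sE -fun_conjM mulrAC subrr.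
Qed.

End Curve.

(** * Torsion points *)

Section Torsion.
Context (k : closedFieldType) (g : nat) (C : hyperelliptic_curve k g).
Local Notation A := (coordinate_ring C).
Local Notation P := (curveP C).
Local Notation Q := (curveQ C).

Lemma abel_jacobi_torsion (p : curve_point C) N :
  abel_jacobi p *+ N = 0 <->
  exists f h : A, is_divisor_of f h ((<< p >> - << infty C >>) *+ N).
Proof.
pose D := Divisor0 (abel_jacobi_subproof p).
have DN : divisor0_val (D *+ N) = (<< p >> - << infty C >>) *+ N.
  exact: (raddfMn \val N D).
have -> : abel_jacobi p *+ N = \pi_(jacobian C)%qT (D *+ N).
  by rewrite raddfMn.
have -> : (\pi_(jacobian C)%qT (D *+ N) = 0) <-> (D *+ N \in @principal k g C).
  rewrite -[D *+ N \in _]/(_ \in (@principal k g C : zmodClosed _)).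
  rewrite -[X in X \in _]subr0 Quotient.idealrBE.
  by rewrite raddf0; split=> /eqP.
by rewrite -DN; split=> [/asboolP|?]; last apply/asboolP.
Qed.

Lemma coeff_multiple (p q : curve_point C) N :
  coeff q ((<< p >> - << infty C >>) *+ N) =
  ((p == q)%:R - (infty C == q)%:R) *+ N :> int.
Proof. by rewrite coeffMn coeffB !coeffU !mul1r. Qed.

Lemma abel_jacobi_infty N : abel_jacobi (infty C) *+ N = 0.
Proof.
apply/abel_jacobi_torsion; exists 1, 1 => p; exists 0, 0.
by split; rewrite ?subrr ?mul0rn ?coeff0 //; apply: has_order1.
Qed.

Lemma on_curve_ramified (p q : affine_point C) :
  (val p).2 *+ 2 + Q.[(val p).1] = 0 -> (val q).1 = (val p).1 -> q = p.
Proof.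
move=> w0 eq1; apply/val_inj; have := on_curveP q; rewrite eq1 -(on_curveP p).
have conjE : - Q.[(val p).1] - (val p).2 = (val p).2.
  by apply/eqP; rewrite -subr_eq0 -oppr_eq0 -w0; apply/eqP; ring.
move=> /quadratic_roots; rewrite conjE => eq2.
have {}eq2 : (val q).2 = (val p).2 by case: eq2.
by rewrite [LHS]surjective_pairing eq1 eq2 -surjective_pairing.
Qed.

(** The divisor of x - a is 2 p - 2 oo. *)
Lemma abel_jacobi_ramified (p : affine_point C) :
  (val p).2 *+ 2 + Q.[(val p).1] = 0 -> abel_jacobi (Some p : curve_point C) *+ 2 = 0.
Proof.
move=> w0; apply/abel_jacobi_torsion.
exists (fun_poly C ('X - ((val p).1)%:P)), 1 => q.
have Xe0 : 'X - ((val p).1)%:P != 0 :> {poly k} by rewrite polyXsubC_eq0.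
case: q => [q|]; last first.
  exists (- 2%:Z), 0; rewrite coeff_multiple; split=> //; last exact: has_order1.
  split; last by rewrite pole_order_poly size_XsubC.
  apply: contra_neq Xe0 => /(congr1 (fun f : A => f`_0)).
  by rewrite coef_fun_poly coef0.
rewrite coeff_multiple; have [->|ne_qp] := eqVneq q p.
  exists 2%:Z, 0; rewrite eqxx; split=> //; last exact: has_order1.
  by exists 2%N => //; rewrite (fun_X p); apply: fun_X_order2.
exists 0, 0; split; last 2 first.
- exact: has_order1.
- by rewrite (_ : Some p == Some q = false) //; apply/negbTE; rewrite eq_sym.
exists 0%N => //; have [t tI] := local_parameter_exists q.
apply: (exact_order0 tI); rewrite /= fun_eval_poly hornerXsubC subr_eq0.
by apply: contra_neq ne_qp => /(on_curve_ramified w0).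
Qed.

Section Contact.
Variables (p : affine_point C) (m : nat).
Hypothesis m_g : m = g \/ m = g.+1.
Hypothesis unramified : (val p).2 *+ 2 + Q.[(val p).1] != 0.
Local Notation N := (m + g).+1.
Local Notation a := (val p).1.
Local Notation b := (val p).2.
Hypothesis torsionN : abel_jacobi (Some p : curve_point C) *+ N = 0.

Lemma torsion_function : exists s : A, [/\ s != 0, pole_order s = N &
  forall q : affine_point C, q != p -> fun_eval q s != 0].
Proof.
have /abel_jacobi_torsion[f [h div_fh]] := torsionN.
have [n1 [n2 [[f0 n1E] [h0 n2E] nE]]] := div_fh None.
have ordE (q : affine_point C) m1 m2 :
    exact_order (in_max_ideal_pow q) m1 f -> exact_order (in_max_ideal_pow q) m2 h ->
    m1%:Z - m2%:Z = (q == p)%:R *+ N.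
  move=> m1f m2h; have [t tI] := local_parameter_exists q.
  have [z1 [z2 [[i1 -> i1f] [i2 -> i2h]]]] := div_fh (Some q).
  rewrite (exact_order_uniq tI m1f i1f) (exact_order_uniq tI m2h i2h) => <-.
  by rewrite coeff_multiple subr0 eq_sym.
have [s sE] : exists s, f = h * s.
  apply: quotient_regular => // q m1 m2 m1f m2h.
  have := ordE q m1 m2 m1f m2h; case: (q == p); last by rewrite mul0rn; lia.
  by rewrite /= mulr1n natz; lia.
have s0 : s != 0 by apply: contra_neq f0 => s0; rewrite sE s0 mulr0.
exists s; split=> // [|q ne_qp].
  have [_] := pole_orderM h0 s0; rewrite -sE => fE.
  move: nE; rewrite coeff_multiple n1E n2E fE /=.
  by rewrite sub0r mulNrn mulr1n natz; lia.
apply/eqP => sq0; have [t tI] := local_parameter_exists q.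
have [m1 m1f] := exact_order_exists q f0; have [m2 m2h] := exact_order_exists q h0.
have := ordE q m1 m2 m1f m2h; rewrite (negPf ne_qp) mul0rn => /eqP.
rewrite subr_eq0 => /eqP[E]; case: (m1f) => _; apply.
rewrite E sE -addn1; apply: (order_geM tI); first by case: m2h.
exact/(order_ge1 tI).
Qed.

(** The roots of the norm of s are the abscissae of the zeros of s, so the norm
    is a multiple of (x - a)^N.  The y-coefficient v of s is nonzero, for
    otherwise s would also vanish at the conjugate of p, and it is constant
    because 2 deg v + 2g + 1 <= N. *)
Lemma torsion_contact : exists (r : {poly k}) (c : k),
  [/\ (size r <= m.+1)%N, r.[a] = b & r ^+ 2 + Q * r - P = c *: ('X - a%:P) ^+ N].
Proof.
have [s [s0 pole_s nz]] := torsion_function.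
have root_p (e : k) : (cnorm s).[e] = 0 -> e = a /\ fun_eval p s = 0.
  have zero (q : affine_point C) : (val q).1 = e -> fun_eval q s = 0 ->
      e = a /\ fun_eval p s = 0.
    by move=> <- qs; have [<-//|/nz] := eqVneq q p; rewrite qs eqxx.
  have [c on_e] := quadratic_root Q.[e] P.[e].
  rewrite (cnorm_eval (mk_point on_e)) => /eqP; rewrite mulf_eq0 => /orP[]/eqP.
    exact: zero.
  exact: (zero (mk_point (conj_on_curve on_e))).
have [rs normE] := closed_field_poly_normal (cnorm s).
set l := lead_coef _ in normE; have l0 : l != 0 by rewrite lead_coef_eq0 cnorm_neq0.
have size_rs : size rs = N.
  have := size_cnorm s0; rewrite normE size_scale // size_prod_XsubC pole_s.
  by case.
have {}normE : cnorm s = l *: ('X - a%:P) ^+ N.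
  rewrite normE; congr (_ *: _); rewrite -size_rs.
  rewrite (eq_big_seq (fun=> 'X - a%:P)) => [|z z_rs].
    by rewrite big_const_seq count_predT iter_mulr_1.
  have /root_p[-> //] : (cnorm s).[z] = 0.
  by apply/eqP; rewrite -[_ == 0]/(root _ _) normE rootZ ?root_prod_XsubC.
have ps0 : fun_eval p s = 0.
  by have /root_p[] : (cnorm s).[a] = 0; rewrite // normE !hornerE subrr expr0n mulr0.
have v0 : s`_1 != 0.
  apply/eqP => v0; have /nz : mk_point (conj_on_curve (on_curveP p)) != p.
    apply: contra_neq unramified => /(congr1 (fun q => (val q).2)) /= bE.
    by rewrite mulr2n -{1}bE; ring.
  by move: ps0; rewrite /fun_eval v0 !horner0 !mul0r => ->; rewrite eqxx.
have [size_u size_v] : (2 * (size (s`_0)%R).-1 <= N /\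
    2 * (size (s`_1)%R).-1 + (2 * g + 1) <= N)%N.
  by move: pole_s; rewrite /pole_order (negPf v0) => <-; rewrite leq_maxl leq_maxr.
have /size_poly1P[d d0 vE] : size s`_1 == 1%N.
  rewrite eqn_leq size_poly_gt0 v0 andbT.
  by move: m_g size_v; move: (size _) => z; clear; lia.
have [r size_r uE] : exists2 r : {poly k}, size r = size s`_0 & s`_0 = - (d *: r).
  exists (- (d^-1 *: s`_0)); first by rewrite size_polyN size_scale ?invr_eq0.
  by rewrite scalerN opprK scalerA mulfV // scale1r.
exists r, (d ^- 2 * l); split.
- by rewrite size_r; move: m_g size_u; move: (size _) => z; clear; lia.
- move: ps0; rewrite /fun_eval vE uE hornerN hornerZ hornerC addrC => /eqP.
  by rewrite subr_eq0 => /eqP/(mulfI d0).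
rewrite -scalerA -normE /cnorm vE uE -!mul_polyC.
rewrite [X in _ = _ * X](_ : _ = (d ^+ 2)%:P * (r ^+ 2 + Q * r - P)); last first.
  by rewrite rmorphXn /=; ring.
by rewrite mulrA -polyCM mulVf ?mul1r // expf_neq0.
Qed.

End Contact.
End Torsion.

(** * Counting *)

Section Count.
Context (k : closedFieldType) (g : nat) (C : hyperelliptic_curve k g) (m : nat).
Local Notation A := (coordinate_ring C).
Local Notation P := (curveP C).
Local Notation Q := (curveQ C).
Hypothesis g_gt0 : (0 < g)%N.
Hypothesis m_g : m = g \/ m = g.+1.
Local Notation N := (m + g).+1.
Local Notation numerator i := ((taylor_numer C (m + g))`_i).

Lemma numerator_neq0 (p : affine_point C) :
  (val p).2 *+ 2 + Q.[(val p).1] != 0 ->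
  exists2 i, (m < i <= m + g)%N & numerator i != 0.
Proof.
move=> w0; apply: contrapT => none.
have zero i : (m < i <= m + g)%N -> numerator i = 0.
  by move=> i_m; apply: contrapT => /eqP nz; apply: none; exists i.
have [N0 _] := contact_of_taylor m_g zero g_gt0 w0.
apply: (@no_full_contact k g m N P Q) => //.
- exact: curveP_monic.
- exact: size_curveP.
- exact: size_curveQ.
- exact: curve_smooth.
- by case: m_g => ->; [left | right]; split=> //; lia.
move=> a b on_ab w_ab.
exact: (contact_of_taylor (p := mk_point on_ab) m_g zero g_gt0 w_ab).2.
Qed.

Lemma numerator_torsion (p : affine_point C) i :
  (val p).2 *+ 2 + Q.[(val p).1] != 0 ->
  abel_jacobi (Some p : curve_point C) *+ N = 0 -> (m < i <= m + g)%N ->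
  ((numerator i)`_0).[(val p).1] = 0 /\ ((numerator i)`_1).[(val p).1] = 0.
Proof.
set a := (val p).1; set b := (val p).2 => w0 pN i_m.
have [r [c [size_r ra rE]]] := torsion_contact m_g w0 pN.
pose p' := mk_point (conj_on_curve (on_curveP p)).
have p_eq0 := taylor_numer_contact w0 size_r ra rE i_m.
have p'_eq0 : fun_eval p' (numerator i) = 0.
  apply: (@taylor_numer_contact _ _ _ _ p' (- Q - r) c) => //=.
  - apply: contra_neq w0 => w'0; rewrite -[LHS]opprK -[RHS]oppr0 -w'0 /=.
    by congr (- _); rewrite -/a -/b; ring.
  - rewrite (leq_trans (size_polyD _ _)) // !size_polyN geq_max size_r andbT.
    by move: m_g (size_curveQ C); move: (size _) => z; clear; lia.
  - by rewrite !hornerE ra.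
  by rewrite -rE; ring.
(* Two equations at b and -Q(a) - b, whose difference is w(p) <> 0. *)
move: p_eq0 p'_eq0; rewrite /fun_eval /= -/a -/b.
set f0 := (_`_0).[a]; set f1 := (_`_1).[a] => e e'.
have f10 : f1 = 0.
  apply/eqP; rewrite -[_ == 0]orbF -(negPf w0) -mulf_eq0 -/a -/b.
  rewrite [X in X == _](_ : _ = (f0 + f1 * b) - (f0 + f1 * (- Q.[a] - b))).
    by rewrite e e' subrr.
  by ring.
by split=> //; move: e; rewrite f10 mul0r addr0.
Qed.

Local Open Scope classical_set_scope.
Local Open Scope card_scope.

Lemma card_le_seq (T : choiceType) (S : set T) (l : seq T) n :
  S `<=` [set` l] -> (size l <= n)%N -> S #<= `I_n.
Proof.
case: l => [|c l] sub_l size_l.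
  have -> : S = set0 by apply/seteqP; split=> // x /sub_l.
  exact: card_ge0.
apply: card_le_trans (subset_card_le sub_l) _.
have -> : [set` c :: l] = (nth c (c :: l)) @` `I_(size (c :: l)).
  apply/seteqP; split=> [x /= /(nthP c)[i lt_i <-]|_ [i lt_i <-]].
    by exists i.
  exact: mem_nth.
apply: card_le_trans (card_image_le _ _) _.
by rewrite card_le_II.
Qed.

Lemma torsion_count :
  range (@abel_jacobi k g C) `&`
    (torsion (jacobian C) N `\` torsion (jacobian C) 2) #<= `I_(4 * g * (m + g)).
Proof.
set S := _ `&` _.
have SE c : S c -> exists2 p : affine_point C,
    c = abel_jacobi (Some p : curve_point C) &
    (val p).2 *+ 2 + Q.[(val p).1] != 0 /\
    abel_jacobi (Some p : curve_point C) *+ N = 0.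
  case=> -[[p|] _ <-] [cN c2]; last by case: c2; apply: abel_jacobi_infty.
  exists p => //; split; last exact: cN.
  by apply/eqP => /abel_jacobi_ramified w0; apply: c2.
have [->|/set0P[c0 /SE[p0 _ [w0 _]]]] := eqVneq S set0; first exact: card_ge0.
have [i i_m fi0] := numerator_neq0 w0.
have [d d0 [size_d d_root]] : exists2 d : {poly k}, d != 0 &
    (2 * (size d).-1 <= 4 * g * i)%N /\
    forall p : affine_point C, (val p).2 *+ 2 + Q.[(val p).1] != 0 ->
      abel_jacobi (Some p : curve_point C) *+ N = 0 -> root d (val p).1.
  have := slope_bounded_taylor C (m + g) i; rewrite /pole_order geq_max.
  case/andP => size0 size1.
  have [f1|f1] := eqVneq (numerator i)`_1 0.
    exists (numerator i)`_0; last split=> // p w_p pN.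
      apply: contra_neq fi0 => f0; rewrite [LHS]coordinate_ringE f0 f1.
      by rewrite /fun_poly polyC0 !rmorph0 mul0r addr0.
    by rewrite rootE (numerator_torsion w_p pN i_m).1.
  exists (numerator i)`_1 => //; split; last first.
    by move=> p w_p pN; rewrite rootE (numerator_torsion w_p pN i_m).2.
  move: size1; rewrite (negPf f1); apply: leq_trans; exact: leq_addr.
have [rs dE] := closed_field_poly_normal d.
have size_rs : size rs = (size d).-1.
  by rewrite [in RHS]dE size_scale ?lead_coef_eq0 // size_prod_XsubC.
(* Above each root z of d there are at most two points. *)
have [y yP] := choice (fun z => quadratic_root Q.[z] P.[z]).
pose pt (z b : k) : jacobian C := abel_jacobi (insub (z, b) : curve_point C).
pose l := [seq pt z (y z) | z <- rs] ++ [seq pt z (- Q.[z] - y z) | z <- rs].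
apply: (@card_le_seq _ _ l); last first.
  rewrite size_cat !size_map size_rs addnn -mul2n (leq_trans size_d) //.
  by rewrite leq_mul2l; case/andP: i_m => _ ->; rewrite orbT.
move=> c /SE[p -> [w_p pN]] /=; have := d_root p w_p pN.
rewrite dE rootZ ?lead_coef_eq0 // root_prod_XsubC => p_rs.
have -> : abel_jacobi (Some p : curve_point C) = pt (val p).1 (val p).2.
  by rewrite /pt -surjective_pairing valK.
have := on_curveP p; rewrite -[in RHS](yP (val p).1) => /quadratic_roots.
rewrite mem_cat => -[->|->]; apply/orP; [left|right]; exact: map_f p_rs.
Qed.

End Count.

Local Open Scope classical_set_scope.
Local Open Scope card_scope.

Theorem proposition1p3 (g : nat) (g_ge1 : (1 <= g)%N) (k : closedFieldType)
    (C : hyperelliptic_curve k g) :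
  (range (@abel_jacobi k g C) `&`
     (torsion (jacobian C) (2 * g + 1) `\` torsion (jacobian C) 2)
   #<= `I_(8 * g ^ 2))
  /\
  (range (@abel_jacobi k g C) `&`
     (torsion (jacobian C) (2 * g + 2) `\` torsion (jacobian C) 2)
   #<= `I_(8 * g ^ 2 + 4 * g)).
Proof.
have odd_count := torsion_count C g_ge1 (or_introl erefl).
have even_count := torsion_count C g_ge1 (or_intror erefl).
split.
  have -> : (2 * g + 1 = (g + g).+1)%N by lia.
  by have -> : (8 * g ^ 2 = 4 * g * (g + g))%N by nia.
have -> : (2 * g + 2 = (g.+1 + g).+1)%N by lia.
by have -> : (8 * g ^ 2 + 4 * g = 4 * g * (g.+1 + g))%N by nia.
Qed.
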